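(* Let $h:\mathbb{N}\to(0,\infty)$ be a growth function and $(H_0,H_1)=(\ell^2,\ell^2_h)$. If the growth type $[h]$ is shift-invariant, then the set $\mathcal{F}_h$ of Floer type weak Hessians has infinitely many connected components.
   Context: $\mathbb{N}=\{1,2,\dots\}$. A growth function is a monotone (nondecreasing) unbounded function $f:\mathbb{N}\to(0,\infty)$. Two growth functions $f,g$ have the same growth type, $f\sim g$, if there is $c>0$ with $\frac1c g(\nu)\le f(\nu)\le c\,g(\nu)$ for all $\nu$; the equivalence class $[f]$ is the growth type of $f$. The growth type $[f]$ is shift-invariant if $f\sim f_1$, where $f_1(\nu):=f(\nu+1)$. For $r\in\mathbb{R}$, $H_r:=\ell^2_{h^r}$ is the Hilbert space of real sequences $x=(x_\nu)_{\nu\in\mathbb{N}}$ with $\sum_\nu h(\nu)^r x_\nu^2<\infty$, with inner product $\langle x,y\rangle_r=\sum_\nu h(\nu)^r x_\nu y_\nu$; for $s<r$ the inclusion $H_r\subset H_s$ is compact and dense. The space of weak Hessians $\mathcal{H}_h\subset\mathcal{L}(H_1,H_0)\cap\mathcal{L}(H_2,H_1)$ consists of all bounded linear maps $A:H_1\to H_0$ which are Fredholm of index zero, $H_0$-symmetric ($\langle Ax,y\rangle_0=\langle x,Ay\rangle_0$ for all $x,y\in H_1$), and which restrict to a bounded linear map $H_2\to H_1$ that is also Fredholm of index zero. It carries the subspace topology from the norm $\max\{\|\cdot\|_{\mathcal{L}(H_1,H_0)},\|\cdot\|_{\mathcal{L}(H_2,H_1)}\}$. The spectrum of $A\in\mathcal{H}_h$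 consists of discrete real eigenvalues of finite multiplicity. $\mathcal{F}_h\subset\mathcal{H}_h$, with the subspace topology, denotes the subset of Floer type weak Hessians, i.e. those with infinitely many positive and infinitely many negative eigenvalues. *)

(* Defs.v *)
From HB Require Import structures.
From mathcomp Require Import all_boot all_order all_algebra.
From mathcomp Require Import all_classical all_reals all_analysis.
From mathcomp Require Import ring lra.

Set Implicit Arguments.
Unset Strict Implicit.
Unset Printing Implicit Defensive.

Import Order.TTheory GRing.Theory Num.Theory.
Import numFieldNormedType.Exports.

Local Open Scope classical_set_scope.
Local Open Scope ring_scope.

(* Sequences indexed by {1, 2, ...} are represented by functions on [nat]
   starting at 0: [h n] stands for h(n + 1). *)
Record growth_function (R : realType) := GrowthFunction {
  growth_fun :> nat -> R ;
  growth_gt0 : forall n, 0 < growth_fun n ;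
  growth_homo : {homo growth_fun : m n / (m <= n)%N >-> m <= n} ;
  growth_unbounded : forall M : R, exists n, M < growth_fun n
}.

Definition same_growth_type (R : realType) (f g : nat -> R) : Prop :=
  exists2 c : R, 0 < c & forall n, c^-1 * g n <= f n /\ f n <= c * g n.

Definition shift_invariant (R : realType) (h : growth_function R) : Prop :=
  same_growth_type h (fun n => h n.+1).

Section weighted_l2.
Variables (R : realType) (h : growth_function R) (r : R).

Definition wl2_term (x y : nat -> R) : R ^nat := fun n => h n `^ r * (x n * y n).

Definition wl2_dot (x y : nat -> R) : R := limn (series (wl2_term x y)).

Definition wl2_pred : {pred nat -> R^o} :=
  fun x => `[< cvgn (series (wl2_term x x)) >].

Lemma wl2_term_cvg x y : x \in wl2_pred -> y \in wl2_pred ->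
  cvgn (series (wl2_term x y)).
Proof.
move=> /asboolP cx /asboolP cy; apply: normed_cvg.
apply: (@series_le_cvg _ _ (wl2_term x x \+ wl2_term y y)) => [n|n|n|].
- exact: normr_ge0.
- by rewrite /= /wl2_term addr_ge0// mulr_ge0 ?powR_ge0// -expr2 sqr_ge0.
- rewrite /= /wl2_term normrM ger0_norm ?powR_ge0// -mulrDr.
  rewrite ler_wpM2l ?powR_ge0// ler_norml; apply/andP; split; nra.
- exact: is_cvg_seriesD.
Qed.

Lemma wl2_dotDl x y z : x \in wl2_pred -> y \in wl2_pred -> z \in wl2_pred ->
  wl2_dot (x + y) z = wl2_dot x z + wl2_dot y z.
Proof.
move=> xP yP zP; rewrite /wl2_dot -lim_seriesD; try exact: wl2_term_cvg.
congr (limn (series _)); apply/funext => n.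
by rewrite /wl2_term /= mulrDl mulrDr.
Qed.

Lemma wl2_dotC x y : wl2_dot x y = wl2_dot y x.
Proof.
by congr (limn (series _)); apply/funext => n; rewrite /wl2_term [x n * _]mulrC.
Qed.

Lemma wl2_dotZl (a : R) x y : x \in wl2_pred -> y \in wl2_pred ->
  wl2_dot (a *: x) y = a * wl2_dot x y.
Proof.
move=> xP yP; rewrite /wl2_dot -[RHS]lim_seriesZ; last exact: wl2_term_cvg.
congr (limn (series _)); apply/funext => n.
rewrite [LHS](_ : _ = h n `^ r * (a * x n * y n))//.
by rewrite [RHS](_ : _ = a * (h n `^ r * (x n * y n)))//; ring.
Qed.

Lemma wl2_submod_closed : submod_closed wl2_pred.
Proof.
split=> [|a x y xP yP].
  apply/asboolP; rewrite (_ : wl2_term 0 0 = 0).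
    by rewrite /series /=; under eq_fun do rewrite big1//; exact: is_cvg_cst.
  by apply/funext => n; rewrite /wl2_term /= mul0r mulr0.
apply/asboolP.
have -> : wl2_term (a *: x + y) (a *: x + y) =
    (a ^+ 2) *: wl2_term x x + ((2 * a) *: wl2_term x y + wl2_term y y).
  apply/funext => n.
  rewrite [RHS](_ : _ = a ^+ 2 * (h n `^ r * (x n * x n)) +
    (2 * a * (h n `^ r * (x n * y n)) + h n `^ r * (y n * y n)))//.
  rewrite [LHS](_ : _ = h n `^ r * ((a * x n + y n) * (a * x n + y n)))//; ring.
apply: is_cvg_seriesD; first exact/is_cvg_seriesZ/wl2_term_cvg.
apply: is_cvg_seriesD; first exact/is_cvg_seriesZ/wl2_term_cvg.
exact: wl2_term_cvg.
Qed.


HB.instance Definition _ :=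
  GRing.isSubmodClosed.Build R (nat -> R^o) wl2_pred wl2_submod_closed.

(* The space [H_r]; the weights are real powers [powR]. *)
Record wl2 := WL2 { wl2_seq :> nat -> R^o ; wl2P : wl2_seq \in wl2_pred }.

HB.instance Definition _ := [isSub for wl2_seq].
HB.instance Definition _ := [Choice of wl2 by <:].
HB.instance Definition _ := [SubChoice_isSubLmodule of wl2 by <:].

Definition wl2_norm (x : wl2) : R := Num.sqrt (wl2_dot x x).

Lemma wl2_dotDr (x y z : wl2) : wl2_dot x (y + z) = wl2_dot x y + wl2_dot x z.
Proof. by rewrite wl2_dotC wl2_dotDl ?wl2P// !(wl2_dotC x). Qed.

Lemma wl2_dotZr (a : R) (x y : wl2) : wl2_dot x (a *: y) = a * wl2_dot x y.
Proof. by rewrite wl2_dotC wl2_dotZl ?wl2P// !(wl2_dotC x). Qed.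

Lemma wl2_term_ge0 (x : nat -> R) n : 0 <= wl2_term x x n.
Proof. by rewrite mulr_ge0 ?powR_ge0// -expr2 sqr_ge0. Qed.

Lemma wl2_term_le_dot (x : wl2) n : wl2_term x x n <= wl2_dot x x.
Proof.
have ndx : {homo series (wl2_term x x) : m k / (m <= k)%N >-> m <= k}.
  by apply/nondecreasing_seqP => k; rewrite seriesSr lerDl wl2_term_ge0.
apply: (@le_trans _ _ (series (wl2_term x x) n.+1)).
  by rewrite seriesSr lerDr /series /= sumr_ge0// => k _; exact: wl2_term_ge0.
by apply: nondecreasing_cvgn_le => //; apply: wl2_term_cvg; exact: wl2P.
Qed.

Lemma wl2_dot_ge0 (x : wl2) : 0 <= wl2_dot x x.
Proof. exact: le_trans (wl2_term_ge0 x 0) (wl2_term_le_dot x 0). Qed.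

Lemma wl2_norm_sqr (x : wl2) : wl2_norm x ^+ 2 = wl2_dot x x.
Proof. by rewrite sqr_sqrtr ?wl2_dot_ge0. Qed.

Lemma wl2_norm_ge0 (x : wl2) : 0 <= wl2_norm x.
Proof. exact: sqrtr_ge0. Qed.

Lemma wl2_normr0_eq0 (x : wl2) : wl2_norm x = 0 -> x = 0.
Proof.
move=> x0; apply/val_inj/funext => n; apply/eqP; rewrite -sqrf_eq0.
have := wl2_term_le_dot x n; rewrite -wl2_norm_sqr x0 expr0n /=.
by rewrite /wl2_term -expr2 pmulr_rle0 ?powR_gt0 ?growth_gt0// eq_le sqr_ge0 andbT.
Qed.

Lemma wl2_normrZ (a : R) (x : wl2) : wl2_norm (a *: x) = `|a| * wl2_norm x.
Proof.
rewrite /wl2_norm wl2_dotZr wl2_dotZl ?wl2P// mulrA -expr2 sqrtrM ?sqr_ge0//.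
by rewrite sqrtr_sqr.
Qed.

Lemma wl2_cauchy (x y : wl2) : wl2_dot x y <= wl2_norm x * wl2_norm y.
Proof.
have [x0|x0] := eqVneq (wl2_norm x) 0.
  have e : x = 0 *: x by rewrite scale0r; exact: wl2_normr0_eq0.
  by rewrite x0 mul0r e wl2_dotZl ?wl2P// mul0r.
have [y0|y0] := eqVneq (wl2_norm y) 0.
  have e : y = 0 *: y by rewrite scale0r; exact: wl2_normr0_eq0.
  by rewrite y0 mulr0 e wl2_dotZr mul0r.
have := wl2_dot_ge0 (wl2_norm y *: x + (- wl2_norm x) *: y).
rewrite wl2_dotDr !wl2_dotZr !wl2_dotDl ?wl2P// !wl2_dotZl ?wl2P//.
rewrite (wl2_dotC y x) -!wl2_norm_sqr.
have xgt : 0 < wl2_norm x by rewrite lt_neqAle eq_sym x0 wl2_norm_ge0.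
have ygt : 0 < wl2_norm y by rewrite lt_neqAle eq_sym y0 wl2_norm_ge0.
have xygt := mulr_gt0 xgt ygt.
move=> H; rewrite -(ler_pM2l xygt); nra.
Qed.

Lemma wl2_ler_normD (x y : wl2) : wl2_norm (x + y) <= wl2_norm x + wl2_norm y.
Proof.
rewrite -(@ler_pXn2r _ 2)// ?nnegrE ?addr_ge0 ?wl2_norm_ge0//.
rewrite wl2_norm_sqr wl2_dotDr !wl2_dotDl ?wl2P// (wl2_dotC y x).
rewrite -!wl2_norm_sqr; have := wl2_cauchy x y; nra.
Qed.

HB.instance Definition _ :=
  Lmodule_isNormed.Build R wl2 wl2_ler_normD wl2_normrZ wl2_normr0_eq0.

End weighted_l2.


Section wl2_inclusion.
Variables (R : realType) (h : growth_function R).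

Lemma wl2_pred_le (r s : R) (x : nat -> R) : s <= r ->
  x \in wl2_pred h r -> x \in wl2_pred h s.
Proof.
move=> sr /asboolP cx; apply/asboolP.
apply: (@series_le_cvg _ _ ((h 0 `^ (s - r)) *: wl2_term h r x x)) => [n|n|n|].
- exact: wl2_term_ge0.
- by rewrite mulr_ge0 ?powR_ge0// wl2_term_ge0.
- rewrite [leRHS](_ : _ = h 0 `^ (s - r) * (h n `^ r * (x n * x n)))//.
  rewrite mulrA ler_wpM2r// -?expr2 ?sqr_ge0//.
  have -> : h n `^ s = h n `^ (s - r) * h n `^ r.
    by rewrite -powRD ?subrK// (gt_eqF (growth_gt0 h n)) implybT.
  rewrite ler_wpM2r ?powR_ge0// -opprB !powRN.
  rewrite lef_pV2 ?posrE ?powR_gt0 ?growth_gt0//.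
  by rewrite ge0_ler_powR ?nnegrE ?subr_ge0 ?(ltW (growth_gt0 _ _))// growth_homo.
- exact: is_cvg_seriesZ.
Qed.

Definition wl2_incl (r s : R) (sr : s <= r) (x : wl2 h r) : wl2 h s :=
  WL2 (wl2_pred_le sr (wl2P x)).

End wl2_inclusion.

Section bounded_linear_maps.
Variables (R : realType) (E F : normedModType R).

Definition bounded_linear_pred : {pred E -> F} := fun f =>
  `[< linear f /\ exists M : R, forall x, `|f x| <= M * `|x| >].

Lemma bounded_linear_submod_closed : submod_closed bounded_linear_pred.
Proof.
split=> [|a f g /asboolP[lf [M fM]] /asboolP[lg [N gN]]]; apply/asboolP; split.
- by move=> a x y; rewrite scaler0 addr0.
- by exists 0 => x; rewrite normr0 mul0r.
- move=> b x y; have E0 z : (a *: f + g) z = a *: f z + g z by [].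
  by rewrite !E0 lf lg !scalerDr !scalerA [a * b]mulrC addrACA.
- exists (`|a| * M + N) => x; rewrite (le_trans (ler_normD _ _))//.
  by rewrite normrZ mulrDl -mulrA lerD// ler_wpM2l.
Qed.

HB.instance Definition _ := GRing.isSubmodClosed.Build R (E -> F)
  bounded_linear_pred bounded_linear_submod_closed.

Record bounded_linear := BoundedLinear {
  bounded_linear_fun :> E -> F ;
  bounded_linearP : bounded_linear_fun \in bounded_linear_pred }.

HB.instance Definition _ := [isSub for bounded_linear_fun].
HB.instance Definition _ := [Choice of bounded_linear by <:].
HB.instance Definition _ := [SubChoice_isSubLmodule of bounded_linear by <:].

Lemma bounded_linear_linear (f : bounded_linear) : linear f.
Proof. by have /asboolP[] := bounded_linearP f. Qed.

HB.instance Definition _ (f : bounded_linear) :=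
  GRing.isLinear.Build R E F *:%R f (bounded_linear_linear f).

Definition op_norm (f : bounded_linear) : R :=
  sup [set `|f x| | x in [set x | `|x| <= 1]].

Let op_norm_has_sup (f : bounded_linear) :
  has_sup [set `|f x| | x in [set x | `|x| <= 1]].
Proof.
split; first by exists `|f 0|, 0 => //=; rewrite normr0.
have /asboolP[_ [M fM]] := bounded_linearP f.
exists `|M| => _ [x /= x1 <-]; rewrite (le_trans (fM x))//.
rewrite (le_trans (ler_wpM2r _ (ler_norm M)))//.
by rewrite -[leRHS]mulr1 ler_wpM2l.
Qed.

Lemma op_norm_ge0 (f : bounded_linear) : 0 <= op_norm f.
Proof.
rewrite (@le_trans _ _ `|f 0|)//; apply: ub_le_sup.
  by have [] := op_norm_has_sup f.
by exists 0 => //=; rewrite normr0.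
Qed.

Lemma op_normP (f : bounded_linear) x : `|f x| <= op_norm f * `|x|.
Proof.
have [->|x0] := eqVneq x 0; first by rewrite linear0 !normr0 mulr0.
rewrite -ler_pdivrMr ?normr_gt0//; apply: ub_le_sup.
  by have [] := op_norm_has_sup f.
exists (`|x|^-1 *: x) => /=; first by rewrite normfZV.
by rewrite linearZ/= normrZ normfV normr_id mulrC.
Qed.

Lemma op_norm_le (f : bounded_linear) (M : R) : 0 <= M ->
  (forall x, `|f x| <= M * `|x|) -> op_norm f <= M.
Proof.
move=> M0 fM; apply: ge_sup; first by have [] := op_norm_has_sup f.
by move=> _ [x /= x1 <-]; rewrite (le_trans (fM x))// -[leRHS]mulr1 ler_wpM2l.
Qed.

Lemma op_normr0_eq0 (f : bounded_linear) : op_norm f = 0 -> f = 0.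
Proof.
move=> f0; apply/val_inj/funext => x; apply/eqP; rewrite -normr_le0.
by rewrite (le_trans (op_normP f x))// f0 mul0r.
Qed.

Lemma op_ler_normD (f g : bounded_linear) :
  op_norm (f + g) <= op_norm f + op_norm g.
Proof.
apply: op_norm_le => [|x]; first by rewrite addr_ge0 ?op_norm_ge0.
by rewrite (le_trans (ler_normD _ _))// mulrDl lerD ?op_normP.
Qed.

Lemma op_normrZ (a : R) (f : bounded_linear) :
  op_norm (a *: f) = `|a| * op_norm f.
Proof.
have le_normZ b (g : bounded_linear) : op_norm (b *: g) <= `|b| * op_norm g.
  apply: op_norm_le => [|x]; first by rewrite mulr_ge0 ?op_norm_ge0.
  by rewrite [X in `|X|](_ : _ = b *: g x)// normrZ -mulrA ler_wpM2l ?op_normP.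
apply/eqP; rewrite eq_le le_normZ /=.
have [->|a0] := eqVneq a 0; first by rewrite normr0 mul0r op_norm_ge0.
rewrite -ler_pdivlMl ?normr_gt0// -normfV.
by rewrite -{1}[f](scalerK a0) le_normZ.
Qed.

HB.instance Definition _ := Lmodule_isNormed.Build R bounded_linear
  op_ler_normD op_normrZ op_normr0_eq0.

End bounded_linear_maps.

(* [V / W] has dimension [n]: the classes of some [e_0, ..., e_(n-1)] in [V]
   form a basis of the quotient. *)
Definition quotient_dim (R : realType) (U : lmodType R) (V W : set U) (n : nat) :=
  exists2 e : 'I_n -> U, (forall i, V (e i)) &
    forall v, V v -> exists! a : 'I_n -> R, W (v - \sum_i a i *: e i).

Definition fredholm_of_index (R : realType) (E F : normedModType R)
    (f : bounded_linear E F) (k : int) : Prop :=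
  closed (range f) /\
  exists m n : nat, [/\ quotient_dim [set x | f x = 0] [set 0] m,
    quotient_dim setT (range f) n & k = m%:Z - n%:Z].

Lemma ler12 (R : realType) : (1 : R) <= 2.
Proof. by rewrite ler1n. Qed.

Section weak_hessians.
Variables (R : realType) (h : growth_function R).

Local Notation H := (wl2 h).

(* The intersection of [L(H_1, H_0)] and [L(H_2, H_1)] sits inside this product
   as the set of pairs [(A, B)] where [B] is the restriction of [A]; the norm on
   the product is the maximum of the two operator norms. *)
Definition hessian_space : normedModType R :=
  (bounded_linear (H 1) (H 0) * bounded_linear (H 2) (H 1))%type.

Definition restricts_to (A : bounded_linear (H 1) (H 0))
    (B : bounded_linear (H 2) (H 1)) : Prop :=
  forall x : H 2, wl2_incl ler01 (B x) = A (wl2_incl (ler12 R) x).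

Definition H0_symmetric (A : bounded_linear (H 1) (H 0)) : Prop :=
  forall x y : H 1, wl2_dot h 0 (A x) (wl2_incl ler01 y) =
                    wl2_dot h 0 (wl2_incl ler01 x) (A y).

Definition weak_hessian : set hessian_space := [set A |
  [/\ fredholm_of_index A.1 0, H0_symmetric A.1,
      restricts_to A.1 A.2 & fredholm_of_index A.2 0]].

Definition hessian_eigenvalue (A : hessian_space) (l : R) : Prop :=
  exists2 x : H 1, x != 0 & A.1 x = l *: wl2_incl ler01 x.

(* Eigenvalues have finite multiplicity, so counting them as a set of reals or
   with multiplicity makes no difference here. *)
Definition floer_hessian : set hessian_space := weak_hessian `&` [set A |
  infinite_set [set l | hessian_eigenvalue A l /\ 0 < l] /\
  infinite_set [set l | hessian_eigenvalue A l /\ l < 0]].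

End weak_hessians.

Arguments weak_hessian {R} h _.
Arguments floer_hessian {R} h _.

(* Main.v *)
(* A symmetric A : H_1 -> H_0 is encoded by T = L^-1 A on H_1, where L is the
   multiplication by the square root of h; T is symmetric for the H_(1/2) inner
   product [x, y] = <L x, y>_0, and [T x, y] = <A x, y>_0.  Say that A has
   positive growth b if, for some C and every n, there is an n-dimensional space
   on which |x|_1^2 <= C b^n [x, x] and <A x, x>_0 >= 0.

   This property is locally constant on weak Hessians.  By Lax's theorem, an
   operator on H_1 which is symmetric for [.,.] has H_(1/2) norm at most its H_1
   norm.  Applied to differences, it controls the form of A under perturbations;
   applied to the inverse of A, it yields a spectral gap [T x, T x] >= d [x, x]
   (A is made invertible by a finite rank term, which costs finitely many
   dimensions, absorbed by C since b^n has shift-invariant growth type).  Given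
   the gap, y = T x + M x turns [T x, x] >= - e [x, x] into
   [T y, y] >= e [y, y], so the sign condition survives small perturbations.

   Since [h] is shift-invariant, one can choose indices along which the square
   root of h is comparable to b^i; the diagonal operator with entries
   +- sqrt (h n), positive exactly at these indices, has positive growth b but not
   b' for b' < b.  Infinitely many values of b give infinitely many components. *)

Require Import Defs.
From HB Require Import structures.
From mathcomp Require Import all_boot all_order all_algebra.
From mathcomp Require Import all_classical all_reals all_analysis.
From mathcomp Require Import ring lra.

Set Implicit Arguments.
Unset Strict Implicit.
Unset Printing Implicit Defensive.

Import Order.TTheory GRing.Theory Num.Theory.
Import numFieldNormedType.Exports.

Local Open Scope classical_set_scope.
Local Open Scope ring_scope.

(** * Completeness of weighted sequence spaces *)

Section sequence_space.
Variables (R : realType) (h : growth_function R).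

Lemma wl2_psum_le (r : R) (x : wl2 h r) n :
  series (wl2_term h r x x) n <= wl2_dot h r x x.
Proof.
apply: nondecreasing_cvgn_le; last exact: wl2_term_cvg (wl2P x) (wl2P x).
by apply/nondecreasing_seqP => k; rewrite seriesSr lerDl wl2_term_ge0.
Qed.

Lemma wl2_bounded_psum (r C : R) (x : nat -> R^o) :
  (forall n, series (wl2_term h r x x) n <= C) ->
  x \in wl2_pred h r /\ wl2_dot h r x x <= C.
Proof.
move=> xC; have cx : cvgn (series (wl2_term h r x x)).
  apply: nondecreasing_is_cvgn.
    by apply/nondecreasing_seqP => k; rewrite seriesSr lerDl wl2_term_ge0.
  by exists C => _ [n _ <-].
split; first exact/asboolP.
by apply: limr_le => //; apply: nearW.
Qed.

(** Membership and estimate come together from a termwise bound, so a sequence can be made a vector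
    and bounded at once. *)
Lemma wl2_dominated (r s K : R) (x : nat -> R^o) (y : wl2 h s) : 0 <= K ->
  (forall n, wl2_term h r x x n <= K * wl2_term h s y y n) ->
  x \in wl2_pred h r /\ wl2_dot h r x x <= K * wl2_dot h s y y.
Proof.
move=> K0 xy; apply: wl2_bounded_psum => n.
apply: (@le_trans _ _ (K * series (wl2_term h s y y) n)).
  by rewrite /series /= mulr_sumr ler_sum.
by rewrite ler_wpM2l// wl2_psum_le.
Qed.

Lemma sqr_norm_wl2 (r : R) (x : wl2 h r) : `|x| ^+ 2 = wl2_dot h r x x.
Proof. exact: wl2_norm_sqr. Qed.

Lemma wl2_coord_le (r : R) (x : wl2 h r) n :
  h n `^ r * (x n) ^+ 2 <= `|x| ^+ 2.
Proof. by rewrite sqr_norm_wl2 expr2; exact: wl2_term_le_dot. Qed.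

(** Coordinates are continuous for the norm, so a Cauchy filter converges coordinatewise.
    Completeness of H_0 feeds the Banach-Steinhaus argument below. *)
Lemma wl2_cauchy_cvg (r : R) (F : set_system (wl2 h r)) :
  ProperFilter F -> cauchy F -> cvg F.
Proof.
move=> FF cF.
have cF' e : 0 < e -> exists x : wl2 h r, \forall y \near F, `|x - y| < e.
  move=> e0; have [x Fx] := (cauchyP F).1 cF e e0.
  by exists x; apply: filterS Fx => y; rewrite -ball_normE.
pose l n : R := lim ((fun x : wl2 h r => x n : R^o) @ F).
have cl n : (fun x : wl2 h r => x n : R^o) @ F --> (l n : R^o).
  apply/cauchy_cvgP/cauchyP => e e0.
  have w0 : 0 < h n `^ r by rewrite powR_gt0// growth_gt0.
  have [|x Fx] := cF' (Num.sqrt (h n `^ r) * e); first by rewrite mulr_gt0 ?sqrtr_gt0.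
  exists (x n); rewrite /=; near=> y => /=.
  rewrite -ball_normE /= -(@ltr_pXn2r _ 2)// ?nnegrE ?ltW//.
  rewrite -(ltr_pM2l w0) real_normK ?num_real//.
  have := wl2_coord_le (x - y) n.
  rewrite (_ : (x - y) n = x n - y n)// => /le_lt_trans; apply.
  have : `|x - y| < Num.sqrt (h n `^ r) * e by near: y.
  rewrite -(@ltr_pXn2r _ 2)// ?nnegrE ?mulr_ge0 ?sqrtr_ge0 ?ltW//.
  by rewrite exprMn [Num.sqrt (h n `^ r) ^+ 2]sqr_sqrtr// ltW.
(* Fatou's argument: a partial sum of fixed length passes to the limit along [F] with its bound, and
   the length is let grow afterwards. *)
have near_l e (x : wl2 h r) : 0 < e -> (\forall y \near F, `|x - y| < e) ->
    (fun n => l n - x n) \in wl2_pred h r /\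
    wl2_dot h r (fun n => l n - x n) (fun n => l n - x n) <= e ^+ 2.
  move=> e0 Fx; apply: wl2_bounded_psum => n.
  have cs : (fun y : wl2 h r =>
      series (wl2_term h r (fun n => y n - x n) (fun n => y n - x n)) n : R^o) @ F -->
      (series (wl2_term h r (fun n => l n - x n) (fun n => l n - x n)) n : R^o).
    apply: (@cvg_big R^o) => [|k _]; first exact: (@add_continuous R^o).
    apply: (@cvgMr R _ F _ (fun y : wl2 h r => (y k - x k) * (y k - x k))).
    by apply: cvgM; (apply: cvgB; [exact: cl|exact: cvg_cst]).
  rewrite -(cvg_lim _ cs)//; apply: limr_le; first by apply/cvg_ex; eexists; exact: cs.
  near=> y.
  have -> : series (wl2_term h r (fun n => y n - x n) (fun n => y n - x n)) n =
    series (wl2_term h r (wl2_seq (y - x)) (wl2_seq (y - x))) n by [].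
  rewrite (le_trans (wl2_psum_le _ _))// -sqr_norm_wl2.
  rewrite ler_pXn2r ?nnegrE// ?(ltW e0)// distrC ltW//; near: y.
  exact: Fx.
have lP : l \in wl2_pred h r.
  have [x Fx] := cF' 1 ltr01.
  have [lx _] := near_l _ _ ltr01 Fx.
  rewrite (_ : l = val (WL2 lx + x)); first exact: wl2P.
  by apply/funext => n; rewrite [RHS](_ : _ = (l n - x n) + x n)// subrK.
apply/cvg_ex; exists (WL2 lP); apply/cvgrPdist_lt => e e0.
have e2 : 0 < e / 2 by rewrite divr_gt0.
have [x Fx] := cF' (e / 2) e2.
have [lx lxe] := near_l _ _ e2 Fx.
have {}lxe : `|WL2 lP - x| <= e / 2.
  rewrite -(@ler_pXn2r _ 2)// ?nnegrE// ?(ltW e2)// sqr_norm_wl2.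
  exact: lxe.
near=> y; rewrite -(subrK x (WL2 lP)) -addrA (le_lt_trans (ler_normD _ _))//.
rewrite [ltRHS]splitr ler_ltD//; near: y; exact: Fx.
Unshelve. all: end_near. Qed.

HB.instance Definition _ (r : R) :=
  Uniform_isComplete.Build (wl2 h r) (@wl2_cauchy_cvg r).

End sequence_space.

(** * Symmetrizable operators *)

(** The sequence [C * (b / q) ^+ n] tends to 0. This plays two exponential rates against each other,
    in Lax's theorem and for the diagonal examples. *)
Lemma geometric_dominated (R : realType) (a b q C : R) :
  0 < a -> 0 <= b -> b < q -> exists n, C * b ^+ n < a * q ^+ n.
Proof.
move=> a0 b0 bq; have q0 : 0 < q := le_lt_trans b0 bq.
have : (fun n => C * (b / q) ^+ n) @ \oo --> C * 0.
  apply: cvgMr; apply: cvg_expr.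
  by rewrite ger0_norm ?divr_ge0 ?(ltW q0)// ltr_pdivrMr// mul1r.
rewrite mulr0 => /cvgr_lt/(_ _ a0)[N _ /(_ N (leqnn N))] /= Na.
exists N; rewrite -ltr_pdivrMr ?exprn_gt0//.
by rewrite -mulrA -expr_div_n.
Qed.

Section symmetrizable.
Variables (R : realType) (V : lmodType R) (f : V -> V -> R).
Hypothesis fDl : forall x y z, f (x + y) z = f x z + f y z.
Hypothesis fZl : forall a x y, f (a *: x) y = a * f x y.
Hypothesis fC : forall x y, f x y = f y x.
Hypothesis f_gt0 : forall x, x != 0 -> 0 < f x x.

Lemma form_zerol x : f 0 x = 0.
Proof. by rewrite -(scale0r 0) fZl mul0r. Qed.

Lemma form_ge0 x : 0 <= f x x.
Proof. by have [->|/f_gt0/ltW//] := eqVneq x 0; rewrite form_zerol. Qed.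

Lemma formDr x y z : f x (y + z) = f x y + f x z.
Proof. by rewrite fC fDl !(fC x). Qed.

Lemma formZr a x y : f x (a *: y) = a * f x y.
Proof. by rewrite fC fZl (fC x). Qed.

Lemma form_cauchy x y : f x y ^+ 2 <= f x x * f y y.
Proof.
have [->|y0] := eqVneq y 0; first by rewrite fC !form_zerol mulr0 expr0n.
have := form_ge0 (f y y *: x + (- f x y) *: y).
rewrite formDr !formZr !fDl !fZl (fC y x) => H.
rewrite -(ler_pM2l (f_gt0 y0)); nra.
Qed.

Variable T : V -> V.
Hypothesis T_linear : linear T.
Hypothesis T_sym : forall x y, f (T x) y = f x (T y).

Let TD x y : T (x + y) = T x + T y.
Proof. by have := T_linear 1 x y; rewrite !scale1r. Qed.

Let TZ a x : T (a *: x) = a *: T x.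
Proof.
have T0 : T 0 = 0.
  by have := T_linear (-1) 0 0; rewrite scaler0 addr0 scaleN1r addNr.
by have := T_linear a x 0; rewrite T0 !addr0.
Qed.

(* Lax: the Cauchy-Schwarz inequality makes [n |-> f (T^n x) (T^n x)]
   logarithmically convex, so its first ratio is bounded by its growth rate. *)
Lemma form_lax (M : R) (x : V) : 0 < M ->
  (exists K, forall n, f (iter n T x) (iter n T x) <= K * M ^+ n) ->
  f (T x) (T x) <= M * f x x.
Proof.
move=> M0 [K aK]; have [->|x0] := eqVneq x 0.
  by rewrite -[T 0](_ : 0 = _) ?form_zerol ?mulr0// -[in RHS](scale0r 0) TZ scale0r.
have a0 := f_gt0 x0; rewrite leNgt; apply/negP => MT.
pose a n := f (iter n T x) (iter n T x).
have lconv n : a n.+1 ^+ 2 <= a n * a n.+2.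
  by rewrite {1}/a /= T_sym; exact: form_cauchy.
pose q := a 1%N / a 0%N.
have Mq : M < q by rewrite ltr_pdivlMr.
have q0 : 0 < q := lt_trans M0 Mq.
(* By logarithmic convexity the ratios of consecutive terms never decrease, so each is at least the
   first one, [q]. *)
have growth n : 0 < a n /\ q * a n <= a n.+1.
  elim: n => [|n [an qan]]; first by rewrite divfK ?gt_eqF.
  have an1 : 0 < a n.+1 by apply: lt_le_trans qan; exact: mulr_gt0.
  split=> //; rewrite -(ler_pM2l an); have := lconv n; nra.
have aq n : a 0%N * q ^+ n <= a n.
  elim: n => [|n IH]; first by rewrite expr0 mulr1.
  rewrite exprS mulrCA (le_trans _ (growth n).2)// ler_wpM2l// ltW//.
have [n] := geometric_dominated K a0 (ltW M0) Mq.
by rewrite ltNge (le_trans (aq n) (aK n)).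
Qed.

Variables (d M : R).
Hypotheses (d_gt0 : 0 < d) (M_gt0 : 0 < M) (dM : d < M ^+ 2).
Hypothesis Tge : forall x, d * f x x <= f (T x) (T x).
Hypothesis Tle : forall x, f (T x) (T x) <= M ^+ 2 * f x x.

(* On the spectrum [u = M^2 - t^2] and [v = t^2 - d] are nonnegative, and
   [2M (M + t) v = (M + t)^2 v + u v] with [(M^2 - d) u v = u^2 v + v^2 u]. *)
Let gap x : d * (f (T x) x + M * f x x) <= f (T (T x)) (T x) + M * f (T x) (T x).
Proof.
pose u x := M ^+ 2 *: x + (-1) *: T (T x).
pose v x := T (T x) + (- d) *: x.
have u_ge0 z : 0 <= f (u z) z.
  by rewrite /u fDl !fZl T_sym mulN1r subr_ge0.
have v_ge0 z : 0 <= f (v z) z.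
  by rewrite /v fDl !fZl T_sym mulNr subr_ge0.
(* The three instances stand for [(M + t)^2 v], [u^2 v] and [v^2 u]; since [u + v = M^2 - d], the
   last two add up to [(M^2 - d) u v]. *)
have := v_ge0 (T x + M *: x); have := v_ge0 (u x); have := u_ge0 (v x).
rewrite /u /v !(TD, TZ) !(fDl, fZl, formDr, formZr).
rewrite !T_sym.
set m0 := f x x; set m1 := f x (T x); set m2 := f x (T (T x)).
set m3 := f x (T (T (T x))); set m4 := f x (T (T (T (T x)))).
set m5 := f x (T (T (T (T (T x))))); set m6 := f x (T (T (T (T (T (T x)))))).
move=> uv vu Mv.
have c_gt0 : 0 < (M ^+ 2 - d) * (2 * M) by rewrite !mulr_gt0// subr_gt0.
rewrite -subr_ge0 -(pmulr_rge0 _ c_gt0).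
have := addr_ge0 (addr_ge0 uv vu) (mulr_ge0 (ltW (_ : 0 < M ^+ 2 - d)) Mv).
rewrite subr_gt0 => /(_ dM); congr (_ <= _); ring.
Qed.

(** Spectrally [y] is [(t + M) x]. The inequality [gap] trades the cubic moment of [T] for lower
    ones, and [Tge] trades the quadratic one for [f x x]; the coefficient left on [f (T x) x] is
    nonnegative, and [4 * M * e <= d] makes the gain outweigh the loss. The second bound keeps [y]
    from being small. *)
Lemma form_boost (e : R) (x : V) (y := T x + M *: x) :
  0 <= e -> 4 * M * e <= d -> - e * f x x <= f (T x) x ->
  e * f y y <= f (T y) y /\ M ^+ 2 / 2 * f x x <= f y y.
Proof.
move=> e0 eM; rewrite /y !(TD, TZ, fDl, fZl, formDr, formZr).
have := gap x; have := Tge x; have := form_ge0 x; rewrite !T_sym.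
set m0 := f x x; set m1 := f x (T x); set m2 := f x (T (T x)).
set m3 := f x (T (T (T x))).
move=> m0_ge0 m2_ge m3_ge m1_ge.
have eM2 : 4 * e * m0 * M <= d * m0 by nra.
have e_leM : 4 * e <= M by rewrite -(ler_pM2r M_gt0) -expr2 (le_trans _ (ltW dM))// mulrAC.
split; last first.
  have : M * (- e * m0) <= M * m1 by rewrite ler_wpM2l// ltW.
  have : 0 <= d * m0 by rewrite mulr_ge0// ltW.
  nra.
(* After [gap], the difference of the two sides is at least [(M - e) (m2 - d m0) + (d + M^2 - 2 M e)
   (m1 + e m0)] plus [m0] times [(d - 4 M e) M + 2 (M^2 - d) e + 2 e^2 M + d M]. *)
have : 0 <= (M - e) * (m2 - d * m0) by rewrite mulr_ge0 ?subr_ge0//; nra.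
have c_ge0 : 0 <= d + M ^+ 2 - 2 * M * e by nra.
have := ler_wpM2l c_ge0 m1_ge.
have : 0 <= (d - 4 * M * e) * (M * m0) by rewrite !mulr_ge0 ?subr_ge0// ltW.
have : 0 <= (M ^+ 2 - d) * (e * m0) by rewrite !mulr_ge0 ?subr_ge0// ltW.
have : 0 <= e ^+ 2 * M * m0 by rewrite !mulr_ge0 ?sqr_ge0// ltW.
have : 0 <= d * M * m0 by rewrite !mulr_ge0// ltW.
nra.
Qed.

End symmetrizable.

(** * The intermediate inner product *)

Section weights.
Variables (R : realType) (h : growth_function R).

Local Notation H := (wl2 h).
Local Notation w n := (Num.sqrt (h n)).

Lemma weight_gt0 n : 0 < w n.
Proof. by rewrite sqrtr_gt0 growth_gt0. Qed.

Lemma weight_sqr n : w n ^+ 2 = h n.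
Proof. by rewrite sqr_sqrtr// ltW// growth_gt0. Qed.

Lemma weight_homo m n : (m <= n)%N -> w m <= w n.
Proof. by move=> mn; rewrite ler_wsqrtr// growth_homo. Qed.

Lemma wl2_term0E x y n : wl2_term h 0 x y n = x n * y n.
Proof. by rewrite /wl2_term powRr0 mul1r. Qed.

Lemma wl2_term1E x y n : wl2_term h 1 x y n = w n ^+ 2 * (x n * y n).
Proof. by rewrite /wl2_term powRr1 ?weight_sqr// ltW// growth_gt0. Qed.

Lemma wl2_term_halfE x y n : wl2_term h (2^-1) x y n = w n * (x n * y n).
Proof. by rewrite /wl2_term powR12_sqrt// ltW// growth_gt0. Qed.

Definition incl10 (x : H 1) : H 0 := wl2_incl ler01 x.

Lemma incl10_linear : linear incl10.
Proof. by move=> a x y; apply/val_inj. Qed.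

HB.instance Definition _ := GRing.isLinear.Build R _ _ _ incl10 incl10_linear.

Lemma incl10_inj0 x : incl10 x = 0 -> x = 0.
Proof. by move=> /(congr1 val) /= x0; apply/val_inj. Qed.

Lemma raise_subproof (x : H 1) :
  (fun n => w n * x n : R^o) \in wl2_pred h 0 /\
  wl2_dot h 0 (fun n => w n * x n) (fun n => w n * x n) <= 1 * wl2_dot h 1 x x.
Proof.
apply: wl2_dominated => // n; rewrite wl2_term0E wl2_term1E.
by rewrite mul1r -expr2 exprMn expr2.
Qed.

(** The operator L of the introduction, an isometry of H_1 onto H_0 with inverse [lower]. *)
Definition raise (x : H 1) : H 0 := WL2 (raise_subproof x).1.

Lemma lower_subproof (x : H 0) :
  (fun n => (w n)^-1 * x n : R^o) \in wl2_pred h 1 /\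
  wl2_dot h 1 (fun n => (w n)^-1 * x n) (fun n => (w n)^-1 * x n) <=
    1 * wl2_dot h 0 x x.
Proof.
apply: wl2_dominated => // n; rewrite wl2_term0E wl2_term1E.
by rewrite mul1r -!expr2 -exprMn mulVKf// gt_eqF// weight_gt0.
Qed.

Definition lower (x : H 0) : H 1 := WL2 (lower_subproof x).1.

Lemma norm_le_sqr (r s : R) (x : H r) (y : H s) (C : R) : 0 <= C ->
  wl2_dot h r x x <= C ^+ 2 * wl2_dot h s y y -> `|x| <= C * `|y|.
Proof.
move=> C0; rewrite -!sqr_norm_wl2 -exprMn.
by rewrite ler_pXn2r// nnegrE ?mulr_ge0.
Qed.

Lemma norm_raise x : `|raise x| <= `|x|.
Proof.
rewrite -[leRHS]mul1r; apply: norm_le_sqr => //.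
by rewrite expr1n; exact: (raise_subproof x).2.
Qed.

Lemma norm_lower x : `|lower x| <= `|x|.
Proof.
rewrite -[leRHS]mul1r; apply: norm_le_sqr => //.
by rewrite expr1n; exact: (lower_subproof x).2.
Qed.

Lemma raise_linear : linear raise.
Proof.
move=> a x y; apply/val_inj/funext => n.
rewrite [LHS](_ : _ = w n * (a * x n + y n))//.
by rewrite [RHS](_ : _ = a * (w n * x n) + w n * y n)//; ring.
Qed.

Lemma lower_linear : linear lower.
Proof.
move=> a x y; apply/val_inj/funext => n.
rewrite [LHS](_ : _ = (w n)^-1 * (a * x n + y n))//.
by rewrite [RHS](_ : _ = a * ((w n)^-1 * x n) + (w n)^-1 * y n)//; ring.
Qed.

HB.instance Definition _ := GRing.isLinear.Build R _ _ _ raise raise_linear.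
HB.instance Definition _ := GRing.isLinear.Build R _ _ _ lower lower_linear.

Lemma lowerK : cancel lower raise.
Proof.
move=> x; apply/val_inj/funext => n /=.
by rewrite mulVKf// gt_eqF// weight_gt0.
Qed.

Lemma raiseK : cancel raise lower.
Proof.
move=> x; apply/val_inj/funext => n /=.
by rewrite mulKf// gt_eqF// weight_gt0.
Qed.

(** The exponent one half is the one for which [L^-1 y, x] = <y, x>_0, so that L^-1 A inherits the
    symmetry of A. *)
Definition hdot (x y : H 1) : R := wl2_dot h (2^-1) x y.

Lemma half_le1 : 2^-1 <= 1 :> R.
Proof. by rewrite invf_le1// ler1n. Qed.

Lemma half_pred (x : H 1) : (x : nat -> R^o) \in wl2_pred h (2^-1).
Proof. exact: (wl2_pred_le half_le1 (wl2P x)). Qed.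

Lemma hdotDl x y z : hdot (x + y) z = hdot x z + hdot y z.
Proof. exact: wl2_dotDl (half_pred x) (half_pred y) (half_pred z). Qed.

Lemma hdotZl a x y : hdot (a *: x) y = a * hdot x y.
Proof. exact: (wl2_dotZl a (half_pred x) (half_pred y)). Qed.

Lemma hdotC x y : hdot x y = hdot y x.
Proof. exact: wl2_dotC. Qed.

Lemma hdot_gt0 x : x != 0 -> 0 < hdot x x.
Proof.
move=> x0; rewrite lt_neqAle (wl2_dot_ge0 (wl2_incl half_le1 x)) andbT.
apply: contra x0 => /eqP xx0; apply/eqP.
have : `|wl2_incl half_le1 x| = 0.
  by apply/eqP; rewrite -sqrf_eq0 sqr_norm_wl2; apply/eqP.
by move=> /normr0_eq0 /(congr1 val) /= e; apply/val_inj.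
Qed.

Lemma hdot_le_norm x : hdot x x <= (w 0)^-1 * `|x| ^+ 2.
Proof.
rewrite sqr_norm_wl2; apply: (wl2_dominated _ _).2 => [|n].
  by rewrite invr_ge0 ltW// weight_gt0.
rewrite wl2_term1E wl2_term_halfE [leRHS]mulrA ler_wpM2r -?[x n * _]expr2 ?sqr_ge0//.
rewrite expr2 mulrA ler_peMl ?(ltW (weight_gt0 _))//.
by rewrite mulrC ler_pdivlMr ?weight_gt0// mul1r weight_homo.
Qed.

Lemma norm_incl10 x : `|incl10 x| <= (w 0)^-1 * `|x|.
Proof.
have w0 : 0 <= (w 0)^-1 by rewrite invr_ge0 ltW// weight_gt0.
apply: norm_le_sqr => //; apply: (wl2_dominated _ _).2 => [|n].
  exact: sqr_ge0.
rewrite wl2_term0E wl2_term1E [leRHS]mulrA -[x n * _]expr2 ler_peMl ?sqr_ge0//.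
rewrite -exprMn exprn_ege1// mulrC ler_pdivlMr ?weight_gt0//.
by rewrite mul1r weight_homo.
Qed.

Lemma hdot_lower (x : H 0) (y : H 1) :
  hdot (lower x) y = wl2_dot h 0 x (incl10 y).
Proof.
congr (limn (series _)); apply/funext => n.
by rewrite wl2_term_halfE wl2_term0E mulrA mulVKf// gt_eqF// weight_gt0.
Qed.

(** Since [x, x] is dominated by the squared H_1 norm, [T^n x, T^n x] grows at most like C^(2n), and
    [form_lax] applies with [C ^+ 2]. *)
Lemma hdot_lax (T : H 1 -> H 1) (C : R) : 0 < C -> linear T ->
  (forall x y, hdot (T x) y = hdot x (T y)) ->
  (forall x, `|T x| <= C * `|x|) ->
  forall x, hdot (T x) (T x) <= C ^+ 2 * hdot x x.
Proof.
move=> C0 T_lin T_sym TC x.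
apply: (form_lax hdotDl hdotZl hdotC hdot_gt0 T_lin T_sym); first exact: exprn_gt0.
exists ((w 0)^-1 * `|x| ^+ 2) => n; apply: (le_trans (hdot_le_norm _)).
rewrite -mulrA ler_wpM2l ?invr_ge0 ?(ltW (weight_gt0 _))//.
rewrite -exprM mulnC exprM -exprMn ler_pXn2r ?nnegrE ?mulr_ge0 ?exprn_ge0 ?(ltW C0)//.
elim: n => [|n IH]; first by rewrite expr0 mulr1.
by rewrite /= (le_trans (TC _))// exprS mulrCA ler_wpM2l// ltW.
Qed.

(** Cauchy-Schwarz for [L^-1 A x, x], then Lax for L^-1 A: symmetry upgrades the operator norm to a
    bound of the form by the weaker H_(1/2) norm. *)
Lemma dot_symmetric_le (A : bounded_linear (H 1) (H 0)) (C : R) (x : H 1) :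
  H0_symmetric A -> 0 < C -> `|A| <= C ->
  `|wl2_dot h 0 (A x) (incl10 x)| <= C * hdot x x.
Proof.
move=> A_sym C0 AC; rewrite -hdot_lower.
have xx : 0 <= hdot x x := form_ge0 hdotZl hdot_gt0 x.
rewrite -(@ler_pXn2r _ 2)// ?nnegrE ?mulr_ge0 ?(ltW C0)// real_normK ?num_real//.
apply: (le_trans (form_cauchy hdotDl hdotZl hdotC hdot_gt0 _ _)).
rewrite exprMn [_ ^+ 2 * hdot x x ^+ 2]mulrA ler_wpM2r//.
apply: (@hdot_lax (lower \o A)) => // [a y z|y z|y].
- by rewrite /= !linearP.
- by rewrite [RHS]hdotC /= !hdot_lower A_sym wl2_dotC.
- rewrite /= (le_trans (norm_lower _))// (le_trans (op_normP _ _))//.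
  by rewrite ler_wpM2r.
Qed.

End weights.

(** * Regularization of Fredholm operators *)

Lemma rV_inj_surj (R : realType) (m : nat) (F : 'rV[R]_m -> 'rV[R]_m) :
  linear F -> (forall c, F c = 0 -> c = 0) -> forall b, exists c, F c = b.
Proof.
move=> F_lin F_inj b.
pose G : {linear 'rV[R]_m -> 'rV[R]_m} :=
  HB.pack F (GRing.isLinear.Build _ _ _ _ F F_lin).
have : row_free (lin1_mx G).
  by apply: inj_row_free => v; rewrite mul_rV_lin1; exact: F_inj.
rewrite row_free_unit => GU; exists (b *m invmx (lin1_mx G)).
by rewrite -[F _](mul_rV_lin1 G) mulmxKV.
Qed.

(** Rank-nullity; the kernel may have dimension above [n], hence only [n] rows of a basis are
    kept. *)
Lemma subspace_of_kernel (R : realType) (m n : nat) (F : 'rV[R]_(m + n) -> 'rV[R]_m) :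
  linear F -> exists J : 'M[R]_(n, m + n),
    row_free J /\ forall a, F (a *m J) = 0.
Proof.
move=> F_lin.
pose G : {linear 'rV[R]_(m + n) -> 'rV[R]_m} :=
  HB.pack F (GRing.isLinear.Build _ _ _ _ F F_lin).
pose N := lin1_mx G.
have nN : (n <= \rank (kermx N))%N.
  by rewrite mxrank_ker leq_subRL ?rank_leq_row// leq_add2r rank_leq_col.
exists (pid_mx n *m row_base (kermx N)); split.
  by rewrite /row_free mxrankMfree ?row_base_free// rank_pid_mx.
move=> a; rewrite -[LHS](mul_rV_lin1 G); apply/sub_kermxP.
by rewrite mulmxA (submx_trans (submxMl _ _))// eq_row_base.
Qed.

Section regularization.
Variables (R : realType) (h : growth_function R).

Local Notation H := (wl2 h).
Local Notation w n := (Num.sqrt (h n)).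
Local Notation "<[ x , y ]>" := (wl2_dot h 0 x y).

Lemma dot0Dl (x y z : H 0) : <[x + y, z]> = <[x, z]> + <[y, z]>.
Proof. exact: wl2_dotDl (wl2P x) (wl2P y) (wl2P z). Qed.

Lemma dot0Zl a (x y : H 0) : <[a *: x, y]> = a * <[x, y]>.
Proof. exact: (wl2_dotZl a (wl2P x) (wl2P y)). Qed.

Lemma dot00l (y : H 0) : <[0 : H 0, y]> = 0.
Proof. by have := dot0Zl 0 0 y; rewrite scale0r mul0r. Qed.

Lemma dot0_suml m (a : 'I_m -> R) (x : 'I_m -> H 0) (y : H 0) :
  <[\sum_i a i *: x i, y]> = \sum_i a i * <[x i, y]>.
Proof.
elim/big_rec2: _ => [|i s z _ IH]; first by rewrite dot00l.
by rewrite dot0Dl dot0Zl IH.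
Qed.

Lemma dot0_sumr m (a : 'I_m -> R) (x : 'I_m -> H 0) (y : H 0) :
  <[y, \sum_i a i *: x i]> = \sum_i a i * <[y, x i]>.
Proof.
by rewrite wl2_dotC dot0_suml; apply: eq_bigr => i _; rewrite wl2_dotC.
Qed.

Lemma dot0_eq0 (x : H 0) : <[x, x]> = 0 -> x = 0.
Proof.
by move=> xx; apply/normr0_eq0/eqP; rewrite -sqrf_eq0 sqr_norm_wl2; apply/eqP.
Qed.

Lemma dot0_norm (x y : H 0) : `|<[x, y]>| <= `|x| * `|y|.
Proof.
rewrite ler_norml wl2_cauchy andbT lerNl.
by rewrite -mulN1r -dot0Zl scaleN1r -[X in _ <= X * _]normrN wl2_cauchy.
Qed.

(** For [k] a basis of the kernel of [A] this is the invertible modification of [A]. The added term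
    is symmetric and vanishes on vectors orthogonal to every [k i]. *)
Definition finite_rank_shift m (A : H 1 -> H 0) (k : 'I_m -> H 1) (x : H 1) : H 0 :=
  A x + \sum_i <[incl10 x, incl10 (k i)]> *: incl10 (k i).

Section shift.
Variables (m : nat) (A : bounded_linear (H 1) (H 0)) (k : 'I_m -> H 1).
Hypothesis A_sym : H0_symmetric A.

Let B := finite_rank_shift A k.

Lemma finite_rank_shift_linear : linear B.
Proof.
move=> a x y; rewrite /B /finite_rank_shift bounded_linear_linear incl10_linear.
rewrite scalerDr [RHS]addrACA scaler_sumr -big_split; congr (_ + _).
by apply: eq_bigr => i _; rewrite dot0Dl dot0Zl scalerDl scalerA.
Qed.

Lemma finite_rank_shift_symmetric x y :
  <[B x, incl10 y]> = <[incl10 x, B y]>.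
Proof.
rewrite /B /finite_rank_shift dot0Dl [RHS]wl2_dotDr dot0_suml dot0_sumr.
rewrite A_sym; congr (_ + _); apply: eq_bigr => i _.
by rewrite [in RHS]mulrC (wl2_dotC _ _ (incl10 y)).
Qed.

Lemma finite_rank_shift_bounded : exists2 C, 0 < C & forall x, `|B x| <= C * `|x|.
Proof.
exists (`|A| + \sum_i (w 0)^-1 * `|incl10 (k i)| ^+ 2 + 1).
  by rewrite ltr_wpDl// addr_ge0// sumr_ge0.
move=> x; rewrite !mulrDl -[X in X <= _]addr0 lerD ?mul1r//.
rewrite (le_trans (ler_normD _ _))// lerD//; first exact: op_normP.
rewrite (le_trans (ler_norm_sum _ _ _))// mulr_suml ler_sum// => i _.
rewrite normrZ mulrAC expr2 mulrA ler_wpM2r//.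
by rewrite (le_trans (dot0_norm _ _))// ler_wpM2r// norm_incl10.
Qed.

Lemma finite_rank_shift_fixed x :
  (forall i, <[incl10 x, incl10 (k i)]> = 0) -> B x = A x.
Proof.
by move=> xk; rewrite /B /finite_rank_shift big1 ?addr0// => i _; rewrite xk scale0r.
Qed.

End shift.

(* [A] is symmetric of index zero, so a basis of its kernel is also a basis of a
   complement of its range. *)
Lemma fredholm_shift_bijective (A : bounded_linear (H 1) (H 0)) :
  fredholm_of_index A 0 -> H0_symmetric A ->
  exists m (k : 'I_m -> H 1),
    (forall x, finite_rank_shift A k x = 0 -> x = 0) /\
    (forall y, exists x, finite_rank_shift A k x = y).
Proof.
move=> [_ [m [n [[k kA kP] [g _ gP] mn]]]] A_sym.
move/esym/eqP: mn; rewrite subr_eq0 => /eqP[] mn; case: n / mn g gP => g gP.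
have lin_incl (c : 'I_m -> R) : incl10 (\sum_i c i *: k i) = \sum_i c i *: incl10 (k i).
  by rewrite linear_sum; apply: eq_bigr => i _; rewrite linearZ.
have A_span (c : 'I_m -> R) : A (\sum_i c i *: k i) = 0.
  by rewrite linear_sum big1// => i _; rewrite linearZ/= kA scaler0.
have k_free (c : 'I_m -> R) : \sum_i c i *: k i = 0 -> c = fun=> 0.
  have [a [_ aU]] := kP 0 (linear0 A).
  move=> c0; rewrite -(aU c) /=; last by rewrite c0 subr0.
  by apply: aU => /=; rewrite big1 ?subr0// => i _; rewrite scale0r.
(* By symmetry, a kernel vector in the range of [A] is orthogonal to itself. *)
have range_orth (c : 'I_m -> R) x :
    A x = incl10 (\sum_i c i *: k i) -> c = fun=> 0.
  move=> Ax; apply/k_free/incl10_inj0/dot0_eq0.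
  by rewrite -{1}Ax A_sym A_span wl2_dotC dot00l.
exists m, k; split.
  move=> x Bx.
  (* The finite rank term lies in both kernel and range, so its coefficients vanish; then [x] is in
     the kernel and orthogonal to it. *)
  have Px : \sum_i <[incl10 x, incl10 (k i)]> *: incl10 (k i) = - A x.
    by apply/eqP; rewrite -addr_eq0 addrC; apply/eqP.
  have xk : (fun i => <[incl10 x, incl10 (k i)]>) = fun=> 0.
    apply: (range_orth _ (- x)); rewrite lin_incl linearN /=.
    exact: esym.
  have Ax : A x = 0.
    rewrite -[A x]opprK -Px big1 ?oppr0// => i _.
    by rewrite (_ : <[_, _]> = 0) ?scale0r//; exact: (congr1 (fun f => f i) xk).
  have [a [/= /eqP xa _]] := kP x Ax; rewrite subr_eq0 in xa.
  apply/incl10_inj0/dot0_eq0; rewrite {2}(eqP xa) lin_incl dot0_sumr.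
  by rewrite big1// => i _; rewrite (congr1 (fun f => f i) xk) mulr0.
(* Coordinates modulo the range; their uniqueness is recorded because it makes [c] linear. *)
have /choice[c cP] : forall v, exists c : 'rV[R]_m,
    range A (v - \sum_i c 0 i *: g i) /\
    forall c' : 'rV[R]_m, range A (v - \sum_i c' 0 i *: g i) -> c' = c.
  move=> v; have [a [av aU]] := gP v Logic.I.
  exists (\row_i a i); split.
    by under eq_bigr do rewrite mxE.
  move=> c' /(aU (fun i => c' 0 i)) ->.
  by apply/rowP => i; rewrite mxE.
have c_lin : linear c.
  move=> a x y; apply/esym/(cP _).2.
  have [[x' _ xE] _] := cP x; have [[y' _ yE] _] := cP y.
  exists (a *: x' + y') => //; rewrite linearP /= xE yE.
  rewrite scalerBr scaler_sumr addrACA -opprD -big_split/=; congr (_ - _).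
  by apply: eq_bigr => i _; rewrite !mxE scalerDl scalerA.
pose span (b : 'rV[R]_m) := \sum_i b 0 i *: k i.
have span_lin : linear span.
  move=> a b b'; rewrite /span scaler_sumr -big_split/=; apply: eq_bigr => i _.
  by rewrite !mxE scalerDl scalerA.
have span0 b : span b = 0 -> b = 0.
  move=> /k_free b0; apply/rowP => i; rewrite mxE.
  exact: (congr1 (fun f => f i) b0).
(* The kernel injects into the cokernel by [range_orth], and index zero gives both the dimension
   [m], so the map is onto. *)
have c_surj := @rV_inj_surj R m (fun b => c (incl10 (span b))).
have {}c_surj : forall b, exists b', c (incl10 (span b')) = b.
  apply: c_surj => [a b b'|b cb]; first by rewrite (span_lin a b b') incl10_linear; exact: c_lin.
  have [[x _ xE] _] := cP (incl10 (span b)).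
  have b0 : (fun i => b 0 i) = fun=> 0.
    have sum0 : \sum_i c (incl10 (span b)) 0 i *: g i = 0.
      by rewrite cb big1// => i _; rewrite mxE scale0r.
    apply: (range_orth (fun i => b 0 i) x).
    by rewrite xE [X in _ - X]sum0 [LHS]subr0.
  by apply/rowP => i; rewrite mxE; exact: (congr1 (fun f => f i) b0).
pose gram (b : 'rV[R]_m) := \row_i <[incl10 (span b), incl10 (k i)]>.
have gram_surj : forall b, exists b', gram b' = b.
  apply: rV_inj_surj => [a b b'|b gb].
    by apply/rowP => i; rewrite !mxE (span_lin a b b') incl10_linear dot0Dl dot0Zl.
  apply/span0/incl10_inj0/dot0_eq0.
  have -> : <[incl10 (span b), incl10 (span b)]> = \sum_i b 0 i * gram b 0 i.
    under [RHS]eq_bigr do rewrite mxE.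
    by rewrite -dot0_sumr -lin_incl.
  by rewrite gb big1// => i _; rewrite mxE mulr0.
move=> y; have [b bE] := c_surj (c y).
have [x _ xE] : range A (y - incl10 (span b)).
  have [[y' _ yE] _] := cP y; have [[s' _ sE] _] := cP (incl10 (span b)).
  exists (y' - s') => //; rewrite linearB/= yE sE bE.
  by rewrite opprB addrA subrK.
(* Adding the kernel vector [span d] leaves [A x] unchanged, while the Gram matrix, being
   invertible, lets [d] bring the coefficients of the finite rank term to [b]. *)
have [d dE] := gram_surj (\row_i (b 0 i - <[incl10 x, incl10 (k i)]>)).
exists (x + span d); rewrite /finite_rank_shift (_ : A _ = A x); last by rewrite linearD/= A_span addr0.
rewrite xE -[RHS](subrK (incl10 (span b))); congr (_ + _).
rewrite lin_incl; apply: eq_bigr => i _; congr (_ *: _).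
have /rowP/(_ i) := dE; rewrite !mxE => dEi.
by rewrite linearD dot0Dl [X in _ + X]dEi addrC subrK.
Qed.

End regularization.

(** * Coordinates, truncations and boundedness of symmetric inverses *)

Section unit_vectors.
Variables (R : realType) (h : growth_function R).

Lemma lim_series_single (u : R^nat) k : (forall n, n != k -> u n = 0) ->
  limn (series u) = u k.
Proof.
move=> u0; apply: cvg_lim => //; apply: cvg_near_cst.
exists k.+1 => // n /= kn; rewrite /series /= (bigD1_seq k) ?iota_uniq//=; last first.
  by rewrite mem_index_iota.
by rewrite big1 ?addr0// => i /u0.
Qed.

Let unit_seq k : nat -> R^o := fun n => (n == k)%:R.

Lemma unit_vector_subproof (r : R) k : unit_seq k \in wl2_pred h r.
Proof.
apply: (proj1 (wl2_bounded_psum (C := h k `^ r) _)) => n.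
rewrite /series /=.
have [kn|nk] := ltnP k n.
  rewrite (bigD1_seq k) ?iota_uniq ?mem_index_iota//= big1 => [|i /negbTE ik].
    by rewrite addr0 /wl2_term /unit_seq eqxx !mulr1.
  by rewrite /wl2_term /unit_seq ik !mulr0.
rewrite big_nat big1 ?powR_ge0// => i /= ik.
by rewrite /wl2_term /unit_seq ltn_eqF ?mulr0//; exact: leq_trans nk.
Qed.

Definition unit_vector (r : R) k : wl2 h r := WL2 (unit_vector_subproof r k).

Lemma dot0_unit_vector (x : wl2 h 0) k : wl2_dot h 0 x (unit_vector 0 k) = x k.
Proof.
rewrite /wl2_dot (lim_series_single (k := k)) => [|n /negbTE nk].
  by rewrite wl2_term0E /= /unit_seq eqxx mulr1.
by rewrite wl2_term0E /= /unit_seq nk mulr0.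
Qed.

Definition truncate n (x : wl2 h 1) : wl2 h 1 := \sum_(k < n) x k *: unit_vector 1 k.

Lemma truncateE n x j : truncate n x j = if (j < n)%N then x j else 0.
Proof.
elim: n => [|n IH]; first by rewrite /truncate big_ord0.
rewrite /truncate big_ord_recr -/(truncate n x).
rewrite [LHS](_ : _ = truncate n x j + x n * unit_vector 1 n j)//.
rewrite IH /= /unit_seq [in RHS]ltnS [in RHS]leq_eqVlt; have [->|jn] /= := eqVneq j n.
  by rewrite ltnn add0r mulr1.
by rewrite mulr0 addr0.
Qed.

Lemma truncate_linear n : linear (truncate n).
Proof.
move=> a x y; rewrite /truncate scaler_sumr -big_split; apply: eq_bigr => i _ /=.
by rewrite scalerA -scalerDl.
Qed.

Lemma norm_truncate n x : `|truncate n x| <= `|x|.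
Proof.
rewrite -[leRHS]mul1r; apply: norm_le_sqr => //; rewrite expr1n.
apply: (wl2_dominated _ _).2 => // j; rewrite mul1r !wl2_term1E truncateE.
by case: ifP => // _; rewrite mul0r mulr0 mulr_ge0 ?sqr_ge0// -expr2 sqr_ge0.
Qed.

Lemma norm_le_truncate (x : wl2 h 1) (C : R) : 0 <= C ->
  (forall n, `|truncate n x| <= C) -> `|x| <= C.
Proof.
move=> C0 xC; rewrite -(@ler_pXn2r _ 2)// ?nnegrE// sqr_norm_wl2.
apply: (wl2_bounded_psum _).2 => n.
rewrite (@le_trans _ _ (`|truncate n x| ^+ 2))//; last by rewrite ler_pXn2r ?nnegrE.
rewrite sqr_norm_wl2 (le_trans _ (wl2_psum_le _ n))// /series /=.
by rewrite ler_sum_nat// => i /= ni; rewrite !wl2_term1E truncateE ni.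
Qed.

(* Hellinger-Toeplitz: the truncations of [S] are bounded because [S] is
   symmetric, and uniformly so by Banach-Steinhaus. *)
Lemma symmetric_inverse_bounded (B : wl2 h 1 -> wl2 h 0) (S : wl2 h 0 -> wl2 h 1) :
  linear B -> (forall x, B x = 0 -> x = 0) ->
  (forall x y, wl2_dot h 0 (B x) (incl10 y) = wl2_dot h 0 (incl10 x) (B y)) ->
  (forall y, B (S y) = y) ->
  linear S /\ exists2 C, 0 < C & forall y, `|S y| <= C * `|y|.
Proof.
move=> B_lin B_inj B_sym SK.
pose B' : {linear wl2 h 1 -> wl2 h 0} :=
  HB.pack B (GRing.isLinear.Build _ _ _ _ B B_lin).
have S_lin : linear S.
  move=> a x y; apply/eqP; rewrite -subr_eq0; apply/eqP/B_inj.
  by rewrite -[B _]/(B' _) linearB linearP /= !SK subrr.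
split=> //.
(* Symmetry turns each coordinate of [S y] into an inner product of [y] with a fixed vector. *)
have coord y k : S y k = wl2_dot h 0 y (incl10 (S (unit_vector 0 k))).
  by rewrite -{2}(SK y) B_sym SK dot0_unit_vector.
have : uniform_bounded [set (truncate n \o S) | n in [set: nat]].
  apply: Banach_Steinhauss => [_ [n _ <-]|y]; last first.
    by exists `|S y| => _ [n _ <-]; exact: norm_truncate.
  split=> [r|a x y]; last by rewrite /= S_lin truncate_linear.
  exists (\sum_(k < n) `|r| * `|incl10 (S (unit_vector 0 k))| * `|unit_vector 1 k|).
  move=> y yr; rewrite (le_trans (ler_norm_sum _ _ _))// ler_sum// => k _.
  rewrite normrZ ler_wpM2r// coord (le_trans (dot0_norm _ _))// ler_wpM2r//.
  exact: le_trans yr (ler_norm r).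
move=> /(_ 1)[M SM]; exists (`|M| + 1); first by rewrite ltr_wpDl.
have S1 y : `|y| <= 1 -> `|S y| <= `|M|.
  move=> y1; apply: norm_le_truncate => // n.
  by rewrite (le_trans _ (ler_norm M))//; apply: (SM (truncate n \o S)) => //; exists n.
pose S' : {linear wl2 h 0 -> wl2 h 1} :=
  HB.pack S (GRing.isLinear.Build _ _ _ _ S S_lin).
move=> y; have [->|y0] := eqVneq y 0.
  by rewrite -[S 0]/(S' 0) linear0 !normr0 mulr0.
rewrite -ler_pdivrMr ?normr_gt0//.
have -> : `|S y| / `|y| = `|S (`|y|^-1 *: y)|.
  by rewrite -[S (_ *: _)]/(S' _) linearZ normrZ /= normfV normr_id mulrC.
by rewrite (le_trans (S1 _ _)) ?lerDl// normfZV.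
Qed.

End unit_vectors.

(** * Exponential growth of the positive part *)

Section positive_growth.
Variables (R : realType) (h : growth_function R).

Local Notation H := (wl2 h).
Local Notation "<[ x , y ]>" := (wl2_dot h 0 x y).

(* The [n]th positive eigenvalue of [A] grows at most like [b ^ n], expressed
   without eigenvalues: on an [n]-dimensional space where the quadratic form of
   [A] is nonnegative, the quotient of the [H_1] and [H_(1/2)] norms is small. *)
Definition positive_growth (b : R) (A : H 1 -> H 0) : Prop :=
  exists2 C : R, 0 < C & forall n, exists2 u : 'rV[R]_n -> H 1, linear u &
    forall a, a != 0 -> [/\ u a != 0,
      `|u a| ^+ 2 <= C * b ^+ n * hdot (u a) (u a) &
      0 <= <[A (u a), incl10 (u a)]>].

Lemma coords_linear m (k : 'I_m -> H 1) (n : nat) (u : 'rV[R]_n -> H 1) :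
  linear u -> linear (fun a => \row_i <[incl10 (u a), incl10 (k i)]>).
Proof.
move=> u_lin a x y; apply/rowP => i.
by rewrite !mxE u_lin incl10_linear dot0Dl dot0Zl.
Qed.

Lemma row_free_neq0 m n (J : 'M[R]_(n, m)) (a : 'rV[R]_n) :
  row_free J -> a != 0 -> a *m J != 0.
Proof.
by move=> J_free; apply: contra => /eqP aJ; rewrite -(mulmx_free_eq0 _ J_free) aJ.
Qed.

(** The shifted operator has a bounded inverse, say with constant [c]; Lax applied to the inverse of
    [T] gives [x, x] <= c^2 [T x, T x], which is the gap. *)
Lemma fredholm_shift_gap (A : bounded_linear (H 1) (H 0)) :
  fredholm_of_index A 0 -> H0_symmetric A ->
  exists m (k : 'I_m -> H 1) (T := @lower R h \o finite_rank_shift A k) (d M : R),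
    [/\ [/\ 0 < d, 0 < M & d < M ^+ 2],
        forall x, `|T x| <= M * `|x|,
        forall x, hdot (T x) (T x) <= M ^+ 2 * hdot x x &
        forall x, d * hdot x x <= hdot (T x) (T x)].
Proof.
move=> A_fred A_sym.
have [m [k [B_inj B_surj]]] := fredholm_shift_bijective A_fred A_sym.
have [S SK] := choice B_surj.
have B_sym := finite_rank_shift_symmetric k A_sym.
have B_lin := @finite_rank_shift_linear _ _ _ A k.
have [S_lin [c c0 Sc]] := symmetric_inverse_bounded B_lin B_inj B_sym SK.
have [M0 M00 BM] := finite_rank_shift_bounded A k.
(* The summand [c^-1] serves to make [d < M ^+ 2] strict. *)
exists m, k => T; exists ((c ^+ 2)^-1), (M0 + c^-1).
have T_sym x y : hdot (T x) y = hdot x (T y).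
  by rewrite [RHS]hdotC !hdot_lower B_sym wl2_dotC.
have T_lin : linear T by move=> a x y; rewrite /T /= B_lin lower_linear.
have ST x : S (raise (T x)) = x.
  rewrite lowerK; apply/eqP; rewrite -subr_eq0; apply/eqP/B_inj.
  by rewrite addrC -scaleN1r (B_lin (-1)) SK scaleN1r addNr.
have M_gt0 : 0 < M0 + c^-1 by rewrite addr_gt0 ?invr_gt0.
have TM x : `|T x| <= (M0 + c^-1) * `|x|.
  rewrite (le_trans (norm_lower _))// (le_trans (BM _))// ler_wpM2r//.
  by rewrite lerDl ltW// invr_gt0.
split=> //.
- split=> //; first by rewrite invr_gt0 exprn_gt0.
  by rewrite -exprVn ltr_pXn2r// ?nnegrE ?ltrDr ?invr_ge0 ?(ltW c0) ?(ltW M_gt0).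
- exact: hdot_lax.
move=> x; rewrite -ler_pdivlMl ?invr_gt0 ?exprn_gt0// invrK.
rewrite -{1 2}(ST x); apply: (@hdot_lax _ _ (S \o @raise R h)) => // [a y z|y z|y].
- by rewrite /= raise_linear S_lin.
- rewrite /= hdotC -{1}(raiseK z) -{2}(raiseK y) !hdot_lower.
  by rewrite -{1}(SK (raise z)) B_sym SK wl2_dotC.
- by rewrite /= (le_trans (Sc _))// ler_wpM2l ?norm_raise ?(ltW c0).
Qed.

(** On vectors orthogonal to the [k i], the forms of [A1] and [A2] differ from that of [T] by at
    most e [x, x], and the boost turns the margin -e into e. Taking two operators near [A] lets one
    implication serve both directions. *)
Lemma positive_growth_near (b : R) (A : bounded_linear (H 1) (H 0)) : 0 < b ->
  fredholm_of_index A 0 -> H0_symmetric A ->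
  exists2 e : R, 0 < e & forall A1 A2 : bounded_linear (H 1) (H 0),
    H0_symmetric A1 -> H0_symmetric A2 -> `|A1 - A| <= e -> `|A2 - A| <= e ->
    positive_growth b A1 -> positive_growth b A2.
Proof.
move=> b0 A_fred A_sym.
have [m [k [d [M [[d0 M0 dM] TM Tle Tge]]]]] := fredholm_shift_gap A_fred A_sym.
set T := @lower R h \o _ in TM Tle Tge.
have T_lin : linear T.
  by move=> a x y; rewrite /T /= finite_rank_shift_linear lower_linear.
have T_sym x y : hdot (T x) y = hdot x (T y).
  by rewrite [RHS]hdotC !hdot_lower finite_rank_shift_symmetric// wl2_dotC.
have e0 : 0 < d / (4 * M) by rewrite divr_gt0 ?mulr_gt0.
exists (d / (4 * M)) => //; set e := d / (4 * M) in e0 *.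
move=> A1 A2 A1_sym A2_sym A1e A2e [C C0 A1C].
pose fixed (x : H 1) := forall i, <[incl10 x, incl10 (k i)]> = 0.
have near_form (A' : bounded_linear (H 1) (H 0)) (x : H 1) : H0_symmetric A' -> `|A' - A| <= e -> fixed x ->
    `|<[A' x, incl10 x]> - hdot (T x) x| <= e * hdot x x.
  move=> A'_sym A'e xk; rewrite (hdot_lower (finite_rank_shift A k x)) (finite_rank_shift_fixed A xk).
  have -> : <[A' x, incl10 x]> - <[A x, incl10 x]> = <[(A' - A) x, incl10 x]>.
    by rewrite -mulN1r -dot0Zl -dot0Dl scaleN1r.
  apply: dot_symmetric_le => // y z.
  have sub y1 : (A' - A) y1 = A' y1 + (-1) *: A y1 by rewrite scaleN1r.
  by rewrite !sub dot0Dl dot0Zl wl2_dotDr wl2_dotZr A'_sym A_sym.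
(* The 8 is [4 * M ^+ 2], from the norm of the boost, times [2 / M ^+ 2], from [form_boost]. The
   power of [b] pays for the 2m dimensions lost in making both [x] and [boost x] orthogonal to the
   [k i]. *)
exists (8 * C * b ^+ (m + m)); first by rewrite !mulr_gt0 ?exprn_gt0.
move=> n; have [u u_lin uP] := A1C (m + (m + n))%N.
have [J1 [J1_free J1P]] := subspace_of_kernel (coords_linear k u_lin).
pose u1 a := u (a *m J1).
have u1_lin : linear u1.
  by move=> a x y; rewrite /u1 mulmxDl -scalemxAl u_lin.
pose boost x := T x + M *: x.
have boost_lin : linear (boost \o u1).
  move=> a x y; rewrite /boost /= u1_lin T_lin !scalerDr !scalerA addrACA.
  by rewrite (mulrC M).
have [J2 [J2_free J2P]] := subspace_of_kernel (coords_linear k boost_lin).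
exists (fun a => boost (u1 (a *m J2))) => [a x y|a a0].
  by rewrite mulmxDl -scalemxAl; exact: boost_lin.
have aJ := row_free_neq0 J2_free a0.
have [x0 xC A1x] := uP _ (row_free_neq0 J1_free aJ).
have x_fixed : fixed (u1 (a *m J2)).
  by move=> i; have /rowP/(_ i) := J1P (a *m J2); rewrite !mxE.
have y_fixed : fixed (boost (u1 (a *m J2))).
  by move=> i; have /rowP/(_ i) := J2P a; rewrite !mxE.
rewrite -/(u1 (a *m J2)) in x0 xC A1x.
set x := u1 (a *m J2) in x0 xC A1x x_fixed y_fixed *.
have eM : 4 * M * e <= d by rewrite mulrC divfK// gt_eqF// mulr_gt0.
have xT : - e * hdot x x <= hdot (T x) x.
  have := near_form _ _ A1_sym A1e x_fixed; rewrite ler_norml lerBlDr => /andP[_].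
  by move=> /(le_trans A1x) ?; rewrite mulNr -[leLHS]add0r lerBlDr [leRHS]addrC.
have [yT yx] : e * hdot (boost x) (boost x) <= hdot (T (boost x)) (boost x) /\
    M ^+ 2 / 2 * hdot x x <= hdot (boost x) (boost x) := form_boost (@hdotDl _ h) (@hdotZl _ h) (@hdotC _ h) (@hdot_gt0 _ h)
  T_lin T_sym d0 M0 dM Tge Tle (ltW e0) eM xT.
have xx := hdot_gt0 x0.
have yy : 0 < hdot (boost x) (boost x).
  by apply: lt_le_trans yx; rewrite !mulr_gt0// exprn_gt0.
split.
- by apply: contraTneq yy => ->; rewrite (form_zerol (@hdotZl _ h)) ltxx.
- have y2M : `|boost x| <= 2 * M * `|x|.
    rewrite (le_trans (ler_normD _ _))// normrZ (gtr0_norm M0).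
    by rewrite [2 * M]mulr_natl mulr2n mulrDl lerD2r.
  rewrite (@le_trans _ _ ((2 * M * `|x|) ^+ 2))//.
    by rewrite ler_pXn2r ?nnegrE ?mulr_ge0 ?(ltW M0).
  rewrite exprMn (le_trans (ler_wpM2l (sqr_ge0 _) xC))//.
  rewrite (addnA m m n) exprD.
  have Cb : 0 <= 8 * (C * (b ^+ (m + m) * b ^+ n)).
    by rewrite !mulr_ge0 ?exprn_ge0 ?(ltW b0)// ltW.
  have := ler_wpM2l Cb yx; rewrite !mulrA.
  generalize (hdot x x) (hdot (boost x) (boost x)) => X Y XY.
  by apply: le_trans XY; rewrite le_eqVlt; apply/orP; left; apply/eqP; field.
have := near_form _ _ A2_sym A2e y_fixed.
rewrite ler_norml lerBrDr => /andP[y2 _]; apply: le_trans y2.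
by rewrite addrC subr_ge0.
Qed.

End positive_growth.

(** Both [P] and its negation cut out relatively open subsets of [X]; interiors supply open sets of
    the whole space with these traces. *)
Lemma locally_constant_connected (T : topologicalType) (X : set T) (P : T -> Prop) :
  connected X ->
  (forall x, X x -> \forall y \near x, X y -> (P x <-> P y)) ->
  forall x y, X x -> X y -> P x -> P y.
Proof.
move=> Xc Ploc x y Xx Xy Px.
have clopen (Q : T -> Prop) :
    (forall x, X x -> \forall y \near x, X y -> (Q x -> Q y)) ->
    X `&` [set z | Q z] = X `&` [set z | \forall t \near z, X t -> Q t].
  move=> Qloc; apply/seteqP; split=> z [Xz Qz]; split=> //.
    by apply: filterS (Qloc z Xz) => t + Xt => /(_ Xt Qz).
  exact: nbhs_singleton Qz Xz.
have openQ (Q : T -> Prop) : open [set z | \forall t \near z, X t -> Q t].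
  exact: open_interior.
have P1 : forall x, X x -> \forall y \near x, X y -> (P x -> P y).
  by move=> z Xz; apply: filterS (Ploc z Xz) => t Pt Xt; exact: (Pt Xt).1.
have P2 : forall x, X x -> \forall y \near x, X y -> (~ P x -> ~ P y).
  by move=> z Xz; apply: filterS (Ploc z Xz) => t Pt Xt; apply: contra_not; exact: (Pt Xt).2.
suff : X `&` [set z | P z] = X by move=> XP; move: Xy; rewrite -XP => -[].
apply: Xc; first by exists x.
  by exists [set z | \forall t \near z, X t -> P t]; [exact: openQ|exact: clopen].
exists (~` [set z | \forall t \near z, X t -> ~ P t]).
  by rewrite closedC; exact: openQ.
have := clopen _ P2 => XN; apply/seteqP; split=> z [Xz Pz]; split=> //.
  by move=> Nz; have [_ /(_ Pz)] : (X `&` [set z | ~ P z]) z by rewrite XN.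
apply: contrapT => nPz; apply: Pz.
by have : (X `&` [set z | ~ P z]) z by []; rewrite XN => -[].
Qed.

Lemma positive_growth_connected (R : realType) (h : growth_function R) (b : R)
    (X : set (hessian_space h)) : 0 < b -> X `<=` weak_hessian h -> connected X ->
  forall A B, X A -> X B -> positive_growth b A.1 -> positive_growth b B.1.
Proof.
move=> b0 Xw Xc.
apply: (@locally_constant_connected (hessian_space h) X
  (fun A => positive_growth b (fst A)) Xc) => A XA.
have [A_fred A_sym _ _] := Xw _ XA.
have [e e0 eP] := positive_growth_near b0 A_fred A_sym.
apply/nbhs_normP; exists e => //= B; rewrite /= => AB XB.
have [_ B_sym _ _] := Xw _ XB.
have AA : `|A.1 - A.1| <= e by rewrite subrr normr0 ltW.
have BA : `|B.1 - A.1| <= e.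
  rewrite distrC ltW// (le_lt_trans _ AB)//.
  by rewrite prod_normE /= le_max lexx.
(* [A] itself is one of the two nearby operators, in either order. *)
split; first exact: (eP _ _ A_sym B_sym AA BA).
exact: (eP _ _ B_sym A_sym BA AA).
Qed.

(** * Diagonal Hessians *)

Lemma infinite_set_inj (T : Type) (f : nat -> T) (B : set T) :
  injective f -> (forall n, B (f n)) -> infinite_set B.
Proof.
move=> f_inj fB B_fin; apply: infinite_nat.
rewrite (_ : setT = f @^-1` B); last by apply/seteqP; split=> n //= _; exact: fB.
by apply: finite_preimage => // m n _ _; exact: f_inj.
Qed.

(** Consecutive half-open intervals are disjoint and ordered, so [g] is strictly increasing. *)
Lemma bracketed_inj (R : realType) (a g : nat -> R) :
  {homo a : m n / (m <= n)%N >-> m <= n} ->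
  (forall n, a n <= g n /\ g n < a n.+1) -> injective g.
Proof.
move=> a_homo ag; have lt_g m n : (m < n)%N -> g m < g n.
  by move=> mn; apply: lt_le_trans (ag n).1; apply: lt_le_trans (ag m).2 (a_homo _ _ mn).
move=> m n gmn; have [/lt_g|/lt_g|//] := ltngtP m n; by rewrite gmn ltxx.
Qed.

Lemma bijective_fredholm (R : realType) (E F : normedModType R)
    (f : bounded_linear E F) :
  (forall x, f x = 0 -> x = 0) -> (forall y, exists x, f x = y) ->
  fredholm_of_index f 0.
Proof.
move=> f_inj f_surj; have fT : range f = setT.
  by apply/seteqP; split=> // y _; have [x <-] := f_surj y; exists x.
split; first by rewrite fT; exact: closedT.
exists 0%N, 0%N; split=> //.
- exists (fun=> 0) => [[]//|v /f_inj ->]; exists (fun=> 0); split=> [|a _].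
    by rewrite big_ord0 subr0.
  by apply/funext => -[].
- exists (fun=> 0) => [[]//|v _]; exists (fun=> 0); split=> [|a _].
    by rewrite fT.
  by apply/funext => -[].
Qed.

Section diagonal.
Variables (R : realType) (h : growth_function R) (s : nat -> R).
Hypothesis s_sign : forall n, s n * s n = 1.

Local Notation H := (wl2 h).
Local Notation w n := (Num.sqrt (h n)).

(** Unlike [wl2_dominated], this allows a product of two vectors whose terms have either sign. *)
Lemma wl2_dot_le (r r' K : R) (x y : H r) (z : H r') :
  (forall n, K * wl2_term h r x y n <= wl2_term h r' z z n) ->
  K * wl2_dot h r x y <= wl2_dot h r' z z.
Proof.
move=> xyz; have cxy := wl2_term_cvg (wl2P x) (wl2P y).
rewrite -[leLHS](lim_seriesZ K cxy); apply: ler_lim.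
- exact: is_cvg_seriesZ.
- exact: wl2_term_cvg (wl2P z) (wl2P z).
by apply: nearW => n; apply: ler_sum => k _; exact: xyz.
Qed.

Let weight_powRS (r r' : R) n : r' = r + 1 -> h n `^ r' = h n `^ r * w n ^+ 2.
Proof.
move=> ->; rewrite powRD ?(gt_eqF (growth_gt0 h n)) ?implybT//.
by rewrite powRr1 ?weight_sqr// ltW// growth_gt0.
Qed.

Let diag_seq (x : nat -> R) : nat -> R^o := fun n => s n * (w n * x n).
Let diag_inv_seq (x : nat -> R) : nat -> R^o := fun n => s n * ((w n)^-1 * x n).

Let diag_subproof (r r' : R) (rr' : r' = r + 1) (x : H r') :
  diag_seq x \in wl2_pred h r /\
  wl2_dot h r (diag_seq x) (diag_seq x) <= 1 * wl2_dot h r' x x.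
Proof.
apply: wl2_dominated => // n; rewrite mul1r /wl2_term /diag_seq (weight_powRS n rr').
by rewrite [X in _ * X]mulrACA s_sign mul1r [X in _ * X]mulrACA -expr2 !mulrA.
Qed.

Let diag_inv_subproof (r r' : R) (rr' : r' = r + 1) (x : H r) :
  diag_inv_seq x \in wl2_pred h r' /\
  wl2_dot h r' (diag_inv_seq x) (diag_inv_seq x) <= 1 * wl2_dot h r x x.
Proof.
apply: wl2_dominated => // n; rewrite mul1r /wl2_term /diag_inv_seq (weight_powRS n rr').
rewrite [X in _ * X]mulrACA s_sign mul1r [X in _ * X]mulrACA -invfM -expr2.
rewrite -[leLHS]mulrA mulVKf//.
by rewrite expf_neq0// gt_eqF// weight_gt0.
Qed.

(** The equation is a parameter so that one construction gives both H_1 -> H_0 and H_2 -> H_1. *)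
Definition diag (r r' : R) (rr' : r' = r + 1) (x : H r') : H r :=
  WL2 (diag_subproof rr' x).1.

Let diag_inv (r r' : R) (rr' : r' = r + 1) (x : H r) : H r' :=
  WL2 (diag_inv_subproof rr' x).1.

Lemma diag_bounded_linear (r r' : R) (rr' : r' = r + 1) :
  diag rr' \in @bounded_linear_pred R (H r') (H r).
Proof.
apply/asboolP; split=> [a x y|].
  apply/val_inj/funext => n.
  rewrite [LHS](_ : _ = s n * (w n * (a * x n + y n)))//.
  by rewrite [RHS](_ : _ = a * (s n * (w n * x n)) + s n * (w n * y n))//; ring.
exists 1 => x; apply: norm_le_sqr => //; rewrite expr1n.
exact: (diag_subproof rr' x).2.
Qed.

Definition diag_map (r r' : R) (rr' : r' = r + 1) : bounded_linear (H r') (H r) :=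
  BoundedLinear (diag_bounded_linear rr').

Lemma diag_fredholm (r r' : R) (rr' : r' = r + 1) : fredholm_of_index (diag_map rr') 0.
Proof.
have s_neq0 n : s n != 0.
  by apply/eqP => s0; have := s_sign n; rewrite s0 mul0r => /esym/eqP; rewrite oner_eq0.
apply: bijective_fredholm => [x /(congr1 val) /= x0|y].
  apply/val_inj/funext => n /=; apply/eqP; have /eqP := congr1 (fun f => f n) x0.
  by rewrite /diag_seq /= !mulf_eq0 (negbTE (s_neq0 n)) (gt_eqF (weight_gt0 h n)).
exists (diag_inv rr' y); apply/val_inj/funext => n /=.
rewrite /diag_seq /= /diag_inv_seq mulrCA [X in _ * X]mulrA s_sign mul1r.
by rewrite mulVKf// gt_eqF// weight_gt0.
Qed.

Lemma diag_symmetric : H0_symmetric (diag_map (esym (add0r 1))).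
Proof.
move=> x y; congr (limn (series _)); apply/funext => n.
by rewrite !wl2_term0E /= /diag_seq; ring.
Qed.

Definition diag_hessian : hessian_space h :=
  (diag_map (esym (add0r 1)), diag_map (erefl (2 : R))).

Lemma diag_weak_hessian : weak_hessian h diag_hessian.
Proof.
split; [exact: diag_fredholm|exact: diag_symmetric| |exact: diag_fredholm].
by move=> x; apply/val_inj.
Qed.

Lemma diag_eigenvalue n : hessian_eigenvalue diag_hessian (s n * w n).
Proof.
exists (unit_vector h 1 n).
  apply/eqP => /(congr1 (fun x : H 1 => x n)) /= /eqP.
  by rewrite eqxx oner_eq0.
apply/val_inj/funext => k.
rewrite [LHS](_ : _ = s k * (w k * (k == n)%:R))//.
rewrite [RHS](_ : _ = s n * w n * (k == n)%:R)//.
by have [->|_] := eqVneq k n; rewrite ?mulr0 ?mulr1.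
Qed.

Lemma diag_termE (x : H 1) n :
  wl2_term h 0 (diag_hessian.1 x) (incl10 x) n = s n * w n * x n ^+ 2.
Proof. by rewrite wl2_term0E /= /diag_seq; ring. Qed.

Lemma lower_diag (x : H 1) n : lower (diag_hessian.1 x) n = s n * x n.
Proof.
by rewrite /= /diag_seq mulrCA mulKf// gt_eqF// weight_gt0.
Qed.

End diagonal.

(** * Lacunary sign patterns and their growth *)

Section lacunary.
Variables (R : realType) (h : growth_function R).

Local Notation H := (wl2 h).
Local Notation w n := (Num.sqrt (h n)).

Lemma weight_unbounded (M : R) : exists n, M < w n.
Proof.
have [n Mn] := growth_unbounded h (M ^+ 2); exists n.
have [M0|M0] := ltP M 0; first exact: lt_le_trans M0 (sqrtr_ge0 _).
by rewrite -(@ltr_pXn2r _ 2)// ?nnegrE// weight_sqr.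
Qed.

(** Monotonicity forces the constant for [h] to be at least 1, so it also serves for the square
    root. *)
Lemma shift_invariant_weight : shift_invariant h ->
  exists2 c : R, 1 <= c & forall n, w n.+1 <= c * w n.
Proof.
move=> [c c0 hc]; have hS n : h n.+1 <= c * h n.
  by rewrite -ler_pdivrMl//; exact: (hc n).1.
have c1 : 1 <= c.
  rewrite -(ler_pM2r (growth_gt0 h 0)) mul1r (le_trans _ (hS 0%N))//.
  exact: growth_homo.
exists c => // n; rewrite -(@ler_pXn2r _ 2)// ?nnegrE ?mulr_ge0 ?(ltW c0)//.
rewrite exprMn !weight_sqr (le_trans (hS n))// ler_wpM2r ?(ltW (growth_gt0 _ _))//.
by rewrite expr2 ler_peMl// ltW.
Qed.

Variables (c : R) (c_ge1 : 1 <= c) (wS : forall n, w n.+1 <= c * w n).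
Variables (b : R) (cb : c ^+ 2 < b).

Let b_gt0 : 0 < b.
Proof. by apply: le_lt_trans cb; exact: sqr_ge0. Qed.

Let b_ge1 : 1 <= b.
Proof. by apply: le_trans (ltW cb); exact: exprn_ege1. Qed.

Let index_exists i : exists n, w 0 * b ^+ i <= w n.
Proof. by have [n /ltW] := weight_unbounded (w 0 * b ^+ i); exists n. Qed.

Definition lacunary i := ex_minn (index_exists i).

(** By minimality the previous weight is below the level, and one step multiplies it by at most [c];
    at index 0 the level is already at least [w 0]. *)
Lemma weight_lacunary i : w 0 * b ^+ i <= w (lacunary i) <= c * (w 0 * b ^+ i).
Proof.
rewrite /lacunary; case: ex_minnP => n wn n_min; rewrite wn /=.
case: n wn n_min => [_ _|n _ n_min].
  rewrite mulrCA ler_peMr ?(ltW (weight_gt0 _ _))//.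
  by rewrite mulr_ege1// exprn_ege1.
rewrite (le_trans (wS n))// ler_wpM2l ?(le_trans ler01)//.
by have [/n_min|/ltW//] := leP (w 0 * b ^+ i) (w n); rewrite ltnn.
Qed.

Let bracket_homo : {homo (fun i => w 0 * b ^+ i) : m n / (m <= n)%N >-> m <= n}.
Proof.
by move=> m n mn /=; rewrite ler_pM2l ?weight_gt0// ler_weXn2l.
Qed.

Let bracket_lt i x : x <= c ^+ 2 * (w 0 * b ^+ i) -> x < w 0 * b ^+ i.+1.
Proof.
move=> /le_lt_trans; apply; rewrite [b ^+ i.+1]exprS [ltRHS]mulrCA ltr_pM2r//.
by rewrite mulr_gt0 ?weight_gt0// exprn_gt0.
Qed.

Let lacunary_bracket i :
  w 0 * b ^+ i <= w (lacunary i) /\ w (lacunary i) < w 0 * b ^+ i.+1.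
Proof.
have /andP[le1 le2] := weight_lacunary i; split=> //; apply: bracket_lt.
rewrite (le_trans le2)// ler_wpM2r ?mulr_ge0 ?exprn_ge0 ?(ltW b_gt0)//.
by rewrite expr2 ler_peMl// (le_trans ler01).
Qed.

(** The condition [c ^+ 2 < b] leaves room for one more step inside the bracket. These successors
    carry the negative sign and supply infinitely many negative eigenvalues. *)
Let lacunaryS_bracket i :
  w 0 * b ^+ i <= w (lacunary i).+1 /\ w (lacunary i).+1 < w 0 * b ^+ i.+1.
Proof.
have /andP[le1 le2] := weight_lacunary i; split.
  by rewrite (le_trans le1)// weight_homo.
apply: bracket_lt; rewrite (le_trans (wS _))// expr2 -[leRHS]mulrA.
by rewrite ler_wpM2l// (le_trans ler01).
Qed.

Let w_lacunary_inj := bracketed_inj bracket_homo lacunary_bracket.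
Let w_lacunaryS_inj := bracketed_inj bracket_homo lacunaryS_bracket.

Lemma lacunary_inj : injective lacunary.
Proof. by move=> i j ij; apply: w_lacunary_inj; rewrite ij. Qed.

Lemma lacunaryS_notin i j : lacunary j <> (lacunary i).+1.
Proof.
move=> ji; have : j = i.
  (* The sequence takes the chosen index in bracket [j] and the successor in every other bracket;
     injectivity forces [j = i], where an index would equal its successor. *)
  apply: (@bracketed_inj _ _ (fun k => if k == j then w (lacunary j)
    else w (lacunary k).+1) bracket_homo).
    by move=> k; case: eqP => [->|_]; [exact: lacunary_bracket|exact: lacunaryS_bracket].
  by rewrite eqxx ji; case: eqP => [->|//].
by move=> e; move: ji; rewrite e => /eqP; rewrite -[X in X == _]addn0 -addn1 eqn_add2l.
Qed.

Definition lacunary_sign n : R := if `[< range lacunary n >] then 1 else -1.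

Lemma lacunary_sign_sqr n : lacunary_sign n * lacunary_sign n = 1.
Proof. by rewrite /lacunary_sign; case: ifP; rewrite ?mulr1// mulrNN mulr1. Qed.

Definition lacunary_hessian := @diag_hessian R h _ lacunary_sign_sqr.

Lemma lacunary_sign1 i : lacunary_sign (lacunary i) = 1.
Proof. by rewrite /lacunary_sign asboolT//; exists i. Qed.

Lemma lacunary_floer : floer_hessian h lacunary_hessian.
Proof.
split; first exact: diag_weak_hessian.
split.
  apply: (infinite_set_inj (f := fun i => w (lacunary i)) w_lacunary_inj) => i.
  split; last exact: weight_gt0.
  by rewrite -[w _]mul1r -(lacunary_sign1 i); exact: diag_eigenvalue.
apply: (infinite_set_inj (f := fun i => - w (lacunary i).+1)) => [i j /oppr_inj|i].
  exact: w_lacunaryS_inj.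
split; last by rewrite oppr_lt0 weight_gt0.
have -> : - w (lacunary i).+1 = lacunary_sign (lacunary i).+1 * w (lacunary i).+1.
  rewrite /lacunary_sign asboolF ?mulN1r// => -[j _].
  exact: lacunaryS_notin.
exact: diag_eigenvalue.
Qed.

(** On the span of the first [n] lacunary unit vectors the operator is positive and the weights are
    at most [c * w 0 * b ^+ n], which bounds the quotient of the two norms. *)
Lemma lacunary_positive_growth : positive_growth b (lacunary_hessian.1).
Proof.
exists (c * w 0); first by rewrite mulr_gt0 ?weight_gt0// (lt_le_trans ltr01).
move=> n; pose u (a : 'rV[R]_n) : H 1 := \sum_i a 0 i *: unit_vector h 1 (lacunary i).
have uE a k : u a k = \sum_i a 0 i * (k == lacunary i)%:R.
  by rewrite /u; elim/big_rec2: _ => // i y z _ <-.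
have u_supp a k : u a k != 0 -> exists2 i, (i < n)%N & k = lacunary i.
  move=> uk; apply: contrapT => nk; move/eqP: uk; apply.
  rewrite uE big1// => i _; have [ki|] := eqVneq k (lacunary i); last by rewrite mulr0.
  by exfalso; apply: nk; exists i.
exists u => [a x y|a a0].
  rewrite /u scaler_sumr -big_split; apply: eq_bigr => i _ /=.
  by rewrite !mxE scalerDl scalerA.
split.
- apply: contra a0 => /eqP ua; apply/eqP/rowP => i; rewrite mxE.
  have := uE a (lacunary i); rewrite ua (bigD1 i)//= eqxx mulr1 big1 ?addr0 => [<-//|j ji].
  by rewrite (inj_eq lacunary_inj) val_eqE eq_sym (negbTE ji) mulr0.
- rewrite sqr_norm_wl2.
  pose u' := wl2_incl (half_le1 R) (u a).
  have Cb : 0 <= c * w 0 * b ^+ n.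
    by rewrite !mulr_ge0 ?exprn_ge0 ?(ltW b_gt0)// (le_trans ler01).
  apply: (wl2_dominated (y := u') Cb _).2 => k.
  rewrite wl2_term1E wl2_term_halfE.
  have [u0|/u_supp[i ni ->]] := eqVneq (u a k) 0.
    by rewrite [u' k]u0 u0 !mulr0.
  rewrite [leRHS]mulrA ler_wpM2r -?expr2 ?sqr_ge0// expr2 ler_wpM2r//.
  have /andP[_ /le_trans] := weight_lacunary i; apply; rewrite -mulrA.
  rewrite ler_wpM2l ?(le_trans ler01)//; exact: bracket_homo (ltnW ni).
(* Nonnegativity is obtained by comparing the opposite series with that of the zero vector. *)
have : -1 * wl2_dot h 0 (lacunary_hessian.1 (u a)) (incl10 (u a)) <=
    wl2_dot h 0 (0 : H 0) (0 : H 0).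
  apply: wl2_dot_le => k; rewrite diag_termE [leRHS]wl2_term0E mulN1r.
  rewrite [leRHS](_ : _ = 0 * 0)// mul0r oppr_le0.
  have [->|/u_supp[i _ ->]] := eqVneq (u a k) 0; first by rewrite expr0n mulr0.
  by rewrite lacunary_sign1 mul1r mulr_ge0 ?sqr_ge0// ltW// weight_gt0.
by rewrite dot00l mulN1r oppr_le0.
Qed.

(** Among [n + 1] dimensions some [x != 0] vanishes at the first [n] lacunary indices. Its positive
    part lives on weights at least [w 0 * b ^+ n] and carries at least half of [x, x], too much for
    a rate [b' < b]. *)
Lemma lacunary_growth_optimal (b' : R) : 0 < b' -> b' < b ->
  ~ positive_growth b' (lacunary_hessian.1).
Proof.
move=> b'0 b'b [C C0 growth].
have half_w0 : 0 < w 0 / 2 by rewrite divr_gt0 ?weight_gt0.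
(* The extra factor [b'] accounts for the dimension [n + 1]. *)
have [n] := geometric_dominated (C * b') half_w0 (ltW b'0) b'b.
rewrite ltNge => /negP; apply.
have [u u_lin uP] := growth (n + 1)%N.
have [|J [J_free JP]] := @subspace_of_kernel R n 1 (fun a => \row_(i < n) u a (lacunary i)).
  by move=> a x y; apply/rowP => i; rewrite !mxE u_lin.
have [|x0 xC xA] := uP (const_mx 1 *m J).
  apply: row_free_neq0 => //; apply/eqP => /rowP/(_ 0); rewrite !mxE => /eqP.
  by rewrite oner_eq0.
have xp i : (i < n)%N -> u (const_mx 1 *m J) (lacunary i) = 0.
  by move=> ni; have /rowP/(_ (Ordinal ni)) := JP (const_mx 1); rewrite !mxE.
set x := u _ in x0 xC xA xp.
have xx := hdot_gt0 x0; rewrite -(ler_pM2r xx).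
have -> : C * b' * b' ^+ n * hdot x x = C * b' ^+ (n + 1) * hdot x x.
  by rewrite addn1 exprS mulrA.
apply: le_trans xC; rewrite sqr_norm_wl2.
have -> : w 0 / 2 * b ^+ n * hdot x x = w 0 * b ^+ n / 2 * hdot x x.
  by rewrite (mulrAC (w 0)).
(* Twice the positive part of [x]; [z, x] = [x, x] + <A x, x>_0 is at least [x, x]. *)
pose z := x + lower (lacunary_hessian.1 x).
have zE k : z k = (1 + lacunary_sign k) * x k.
  rewrite [LHS](_ : _ = x k + lower (lacunary_hessian.1 x) k)//.
  by rewrite lower_diag mulrDl mul1r.
have : w 0 * b ^+ n / 2 * hdot z x <= wl2_dot h 1 x x.
  apply: (@wl2_dot_le _ _ (2^-1) 1 _ (wl2_incl (half_le1 R) z)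
    (wl2_incl (half_le1 R) x) x) => k.
  rewrite wl2_term1E wl2_term_halfE [wl2_incl _ z k]zE /=.
  rewrite /lacunary_sign; case: asboolP => [[i _ <-]|_]; last first.
    by rewrite subrr !mul0r !mulr0 mulr_ge0 ?sqr_ge0// -expr2 sqr_ge0.
  have [/xp ->|ni] := ltnP i n; first by rewrite !mulr0.
  have wi := (lacunary_bracket i).1.
  have wn : w 0 * b ^+ n <= w (lacunary i) by exact: le_trans (bracket_homo ni) wi.
  have := weight_gt0 h (lacunary i); move: (w (lacunary i)) wn => W wn W0.
  have -> : w 0 * b ^+ n / 2 * (W * ((1 + 1) * x (lacunary i) * x (lacunary i))) =
    w 0 * b ^+ n * (W * (x (lacunary i) * x (lacunary i))) by field.
  by rewrite expr2 -[leRHS]mulrA ler_wpM2r// mulr_ge0 ?(ltW W0)// -expr2 sqr_ge0.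
apply: le_trans; rewrite ler_wpM2l ?hdotDl ?hdot_lower ?lerDl//.
by rewrite !mulr_ge0 ?exprn_ge0 ?(ltW b_gt0)// ltW// weight_gt0.
Qed.

End lacunary.

(** * Separation of the components *)

Theorem corollary1p6 (R : realType) (h : growth_function R) :
  shift_invariant h ->
  infinite_set [set connected_component (floer_hessian h) A
               | A in floer_hessian h].
Proof.
move=> /shift_invariant_weight[c c_ge1 wS].
(* Increasing rates, all above [c ^+ 2] as the lacunary construction requires; the exponent [k.+1]
   ensures this already at 0. *)
pose b (k : nat) := (c ^+ 2 + 1) ^+ k.+1.
have base_gt1 : 1 < c ^+ 2 + 1 by rewrite ltrDr exprn_gt0// (lt_le_trans ltr01).
have b_homo i j : (i < j)%N -> b i < b j by move=> ij; rewrite ltr_eXn2l.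
have cb k : c ^+ 2 < b k.
  by rewrite (@lt_le_trans _ _ (c ^+ 2 + 1)) ?ltrDl// -[leLHS]expr1 ler_eXn2l.
have b_gt0 k : 0 < b k by rewrite exprn_gt0// (lt_trans ltr01).
pose D k := lacunary_hessian h (b k).
have D_floer k : floer_hessian h (D k) by exact: (lacunary_floer c_ge1 wS (cb k)).
have D_separated i j : (i < j)%N ->
    connected_component (floer_hessian h) (D i) <>
    connected_component (floer_hessian h) (D j).
  (* In a common component the smaller rate [b i] would pass from [D i] to [D j], whose optimal rate
     is [b j]. *)
  move=> ij e; apply: (lacunary_growth_optimal c_ge1 wS (cb j) (b_gt0 i)).
    exact: b_homo.
  apply: (@positive_growth_connected _ _ (b i)
    (connected_component (floer_hessian h) (D i)) _ _ _ (D i) (D j)) => //.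
  - by move=> A /connected_component_sub[].
  - exact: component_connected.
  - exact: connected_component_refl.
  - by rewrite e; exact: connected_component_refl.
  - exact: (lacunary_positive_growth c_ge1 wS (cb i)).
apply: (@infinite_set_inj _ (fun k => connected_component (floer_hessian h) (D k))) => [i j ij|k].
  by have [/D_separated|/D_separated/nesym|//] := ltngtP i j.
by exists (D k).
Qed.
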